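(* Let $P$ be a $d$-polytope. If the Jacobian matrix $J_{\Phi_P}(V_0,A_0)$ of the characteristic map $\Phi_P$ at some point $(V_0,A_0)\in\mathcal{R}_{\mathbf 0}(P)$ has full row rank (that is, rank $f_{0,d-1}(P)$), then $\mathcal{R}_{\mathbf 0}(P)$ is, in a neighborhood of $(V_0,A_0)$, a smooth manifold of dimension $\mathrm{NG}(P)$. In particular, $\dim_{(V_0,A_0)}\mathcal{R}_{\mathbf 0}(P)=\mathrm{NG}(P)$ and $\dim\mathcal{R}_{\mathbf 0}(P)\ge \mathrm{NG}(P)\ge 0$.
   Context: A $d$-polytope is a $d$-dimensional convex polytope. Polytopes are labeled: vertices $\mathbf v_1,\dots,\mathbf v_n$ and facets $F_1,\dots,F_m$ are numbered. Write $f_0(P)=n$, $f_{d-1}(P)=m$, and $f_{0,d-1}(P)$ for the number of pairs (vertex, facet) with the vertex in the facet. A labeled $d$-polytope $Q\subset\mathbb{R}^d$ realizes $P$ if there is an isomorphism between the face lattices of $P$ and $Q$ respecting the labels of vertices and facets. The centered realization space is $$\mathcal{R}_{\mathbf 0}(P)=\{(V,A)\in\mathbb{R}^{d\times(n+m)} \mid \operatorname{conv}(V)=\{\mathbf x\in\mathbb{R}^d\mid A^t\mathbf x\le\mathbf 1\}\text{ realizes }P\},$$ where $\operatorname{conv}(V)$ is the convex hull of the columns of $V$ (column $i$ of $V$ is the $i$-th vertex, column $j$ of $A$ corresponds to the $j$-th facet). It is a semi-algebraic set; $\dim$ and $\dim_x$ denote its dimension and its local dimension at $x$. ''Smooth manifold''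 means smoothly embedded submanifold of $\mathbb{R}^{d\times(n+m)}$. The characteristic map is $\Phi_P:\mathbb{R}^{d\times(n+m)}\to\mathbb{R}^{f_{0,d-1}(P)}$, $\Phi_P(W,B)=(\mathbf w_i^t\mathbf b_j-1)_{[i,j]:\ \mathbf v_i\in F_j}$, where $\mathbf w_i,\mathbf b_j$ are the columns of $W,B$. The natural guess is $\mathrm{NG}(P)=d(f_0(P)+f_{d-1}(P))-f_{0,d-1}(P)$. *)

(* Defs.v *)
From HB Require Import structures.
From mathcomp Require Import all_boot all_order all_algebra.
From mathcomp Require Import all_classical all_reals all_analysis.

Set Implicit Arguments.
Unset Strict Implicit.
Unset Printing Implicit Defensive.

Import Order.TTheory GRing.Theory Num.Theory.
Import numFieldNormedType.Exports.

Local Open Scope classical_set_scope.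
Local Open Scope ring_scope.

(* Points of R^e are column vectors. *)

Section Polytopes.
Context {R : realType}.

Definition dotp e (c x : 'cV[R]_e) : R := (c^T *m x) 0 0.

Definition conv e n (V : 'M[R]_(e, n)) : set 'cV[R]_e :=
  [set x | exists l : 'cV[R]_n,
    [/\ forall i, 0 <= l i 0, \sum_i l i 0 = 1 & x = V *m l]].

(* Columns are affinely independent iff they become linearly independent once
   a coordinate 1 is appended to each of them. *)
Definition aff_indep e r (X : 'M[R]_(e, r)) : Prop :=
  \rank (col_mx X (const_mx 1 : 'rV[R]_r)) = r.

(* The dimension of the affine hull; it is -1 for the empty set. *)
Definition affdim e (S : set 'cV[R]_e) : int :=
  (\max_(r < e.+2 | `[< exists2 X : 'M[R]_(e, r),
      forall j, S (col j X) & aff_indep X >]) r)%:Z - 1.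

(* c = 0 is allowed, so the empty set and P itself are faces of P. *)
Definition face e (P G : set 'cV[R]_e) : Prop :=
  exists (c : 'cV[R]_e) (b : R),
    (forall x, P x -> dotp c x <= b) /\ G = P `&` [set x | dotp c x = b].

Record labeled (e n m : nat) := Labeled {
  body : set 'cV[R]_e;
  vertex : 'I_n -> 'cV[R]_e;
  facet : 'I_m -> set 'cV[R]_e }.

(* A d-polytope may live in a space R^e of larger dimension. *)
Definition labeled_polytope e n m (d : nat) (P : labeled e n m) : Prop :=
  [/\ exists k (W : 'M[R]_(e, k)), body P = conv W,
      affdim (body P) = d%:Z,
      injective (vertex P)
        /\ (forall x, (exists i, vertex P i = x) <-> face (body P) [set x])
    & injective (facet P)
        /\ (forall G, (exists j, facet P j = G) <->
              (face (body P) G /\ affdim G = d%:Z - 1))].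

Definition comb_equiv e e' n m (P : labeled e n m) (Q : labeled e' n m) : Prop :=
  exists f : set 'cV[R]_e -> set 'cV[R]_e',
    [/\ set_bij (face (body P)) (face (body Q)) f,
        forall G H, face (body P) G -> face (body P) H ->
          (G `<=` H <-> f G `<=` f H),
        forall i, f [set vertex P i] = [set vertex Q i]
      & forall j, f (facet P j) = facet Q j].

Definition realizes e n m d (Q : labeled d n m) (P : labeled e n m) : Prop :=
  labeled_polytope d Q /\ comb_equiv P Q.

Definition polar_poly d m (A : 'M[R]_(d, m)) : set 'cV[R]_d :=
  [set x | forall j, (A^T *m x) j 0 <= 1].

Definition labeled_conv d n m (V : 'M[R]_(d, n)) (A : 'M[R]_(d, m)) :
    labeled d n m :=
  Labeled (conv V) (fun i => col i V)
    (fun j => conv V `&` [set x | dotp (col j A) x = 1]).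

(* A pair (V, A) is encoded as the block matrix row_mx V A. *)
Definition centered_realization_space e n m d (P : labeled e n m) :
    set 'M[R]_(d, n + m) :=
  [set W | let V := lsubmx W in let A := rsubmx W in
     conv V = polar_poly A /\ realizes (labeled_conv V A) P].

Definition incidences e n m (P : labeled e n m) : {set 'I_n * 'I_m} :=
  [set ij | `[< facet P ij.2 (vertex P ij.1) >]]%SET.

Definition natural_guess e n m (d : nat) (P : labeled e n m) : int :=
  (d * (n + m))%N%:Z - #|incidences P|%:Z.

Definition char_map e n m d (P : labeled e n m) (W : 'M[R]_(d, n + m)) :
    'rV[R]_#|incidences P| :=
  \row_k let ij := enum_val k in
    dotp (col ij.1 (lsubmx W)) (col ij.2 (rsubmx W)) - 1.

(* The library's Jacobian acts on row vectors: it is the transpose of the usual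
   matrix of partial derivatives, and needs a domain of row vectors. *)
Definition char_jacobian e n m d (P : labeled e n m) (W : 'M[R]_(d, n + m)) :
    'M[R]_(#|incidences P|, d * (n + m)) :=
  (jacobian (fun w => char_map P (vec_mx w)) (mxvec W))^T.

End Polytopes.

Section SmoothManifolds.
Context {R : realType}.

(* Only meaningful when U is open. *)
Fixpoint Ck_on (k : nat) (E F : normedModType R) (U : set E) (f : E -> F) :
    Prop :=
  (forall x, U x -> {for x, continuous f}) /\
  if k is k'.+1 then
    forall v, (forall x, U x -> derivable f x v) /\
              Ck_on k' U (fun x => 'D_v f x)
  else True.

Definition smooth_on (E F : normedModType R) (U : set E) (f : E -> F) : Prop :=
  forall k, Ck_on k U f.

(* A diffeomorphism phi from an open set U onto an open subset of R^(p * q)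
   that carries S to the slice where all coordinates but the first k vanish. *)
Definition slice_chart p q (S : set 'M[R]_(p, q)) (k : nat)
    (U : set 'M[R]_(p, q)) (phi : 'M[R]_(p, q) -> 'rV[R]_(p * q)) : Prop :=
  [/\ open U /\ open (phi @` U),
      smooth_on U phi,
      exists2 psi : 'rV[R]_(p * q) -> 'M[R]_(p, q),
        smooth_on (phi @` U) psi & forall x, U x -> psi (phi x) = x
    & phi @` (S `&` U) = phi @` U `&`
        [set y : 'rV[R]_(p * q) | forall i : 'I_(p * q), (k <= i)%N -> y 0 i = 0]].

Definition smooth_submanifold p q (k : nat) (S : set 'M[R]_(p, q)) : Prop :=
  (k <= p * q)%N /\
  forall x, S x -> exists U phi, U x /\ slice_chart S k U phi.

(* The dimension of a semi-algebraic set in the sense of Lojasiewicz: the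
   largest dimension of a nonempty submanifold contained in it, and -1 for the
   empty set. *)
Definition sdim p q (S : set 'M[R]_(p, q)) : int :=
  \big[Num.max/-1]_(k < (p * q).+1 | `[< exists M : set 'M[R]_(p, q),
      [/\ M !=set0, M `<=` S & smooth_submanifold k M] >]) k%:Z.

Definition has_local_dim p q (S : set 'M[R]_(p, q)) (x : 'M[R]_(p, q))
    (k : int) : Prop :=
  exists2 U, nbhs x U & forall V, nbhs x V -> V `<=` U -> sdim (S `&` V) = k.

End SmoothManifolds.

(* Main.v *)
From HB Require Import structures.
Require Import Defs.
From mathcomp Require Import all_boot all_order all_algebra.
From mathcomp Require Import all_classical all_reals all_analysis.
From mathcomp Require Import ring lra.

(** Why the theorem holds.

    Near a centered realization (V0, A0) the realization space is the zero set
    of the characteristic map ([centered_realizations_near]); since that map is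
    polynomial and its differential at (V0, A0) is onto, the zero set is a
    manifold by the implicit function theorem ([regular_level_set]).

    Zero set.  A realization satisfies the equations v_i . a_j = 1 because an
    isomorphism of face lattices preserves incidences.  Conversely let (V, A) be
    close to (V0, A0) and satisfy these equations.  The products v_i . a_j that
    were smaller than 1 still are, so conv V lies in the polar polyhedron of A
    and the incidences are unchanged.  For the reverse inclusion take y in the
    polyhedron and let J be the set of constraints tight at y.  If some v_i is
    tight on all of J, the ray from v_i through y leaves the polyhedron at a
    point with more tight constraints, and y lies between v_i and that point; an
    induction on the complement of J ends in conv V ([polar_sub_conv]).  Two
    facts are needed: the polyhedron contains no ray, and constraints with no
    common vertex are never tight together.  Both say that a cone is trivial;
    they hold at A0, and by compactness of the unit sphere they persist
    ([cone_trivial_open]).  Once conv V is the polar of A, its faces are the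
    hulls of those sets of vertices that are closed for the incidence relation
    ([face_inc_face], [inc_face_face]), so the face lattice depends on the
    incidences only.  Affine dimensions do not drop under a small perturbation,
    which identifies the facets ([labeled_polytope_transfer]).

    Manifold.  The smooth inverse function theorem ([inverse_function]) comes
    from Banach's fixed point theorem and the fact that a C1 map is strictly
    differentiable ([C1_strict_diff]).  Completing the characteristic map by
    linear coordinates on the kernel of its differential gives one slice chart
    that serves all nearby zeros.

    Dimension.  The local and global dimensions refer to all submanifolds
    contained in the realization space.  If a k-dimensional submanifold lies in
    an l-dimensional one, the differential of a change of charts embeds a
    k-dimensional coordinate space into an l-dimensional one, so k <= l
    ([submanifold_dim_le]). *)

Set Implicit Arguments.
Unset Strict Implicit.
Unset Printing Implicit Defensive.

Import Order.TTheory GRing.Theory Num.Theory.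
Import numFieldNormedType.Exports.

Local Open Scope classical_set_scope.
Local Open Scope ring_scope.

(** * Smooth functions *)

Section SmoothFunctions.
Context {R : realType}.
Implicit Types E F : normedModType R.

Lemma Ck_on_sub k E F (U V : set E) (f : E -> F) :
  V `<=` U -> Ck_on k U f -> Ck_on k V f.
Proof.
move=> VU; elim: k f => [|k IH] f /= [fc fd]; split=> //; first by move=> x /VU/fc.
  by move=> x /VU/fc.
move=> v; have [dv cv] := fd v; split; last exact: IH.
by move=> x /VU/dv.
Qed.

Lemma smooth_on_sub E F (U V : set E) (f : E -> F) :
  V `<=` U -> smooth_on U f -> smooth_on V f.
Proof. by move=> VU fs k; apply: Ck_on_sub VU (fs k). Qed.

Lemma Ck_on_eq k E F (U : set E) (f g : E -> F) :
  open U -> (forall x, U x -> f x = g x) -> Ck_on k U f -> Ck_on k U g.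
Proof.
move=> oU; elim: k f g => [|k IH] f g fg /= [fc fd].
  split=> // x Ux; rewrite /prop_for/continuous_at -(fg _ Ux).
  apply: cvg_trans (fc _ Ux); apply: near_eq_cvg.
  by apply: filterS (open_nbhs_nbhs (conj oU Ux)) => y /fg.
have near_fg x : U x -> {near x, f =1 g}.
  by move=> Ux; apply: filterS (open_nbhs_nbhs (conj oU Ux)) => y /fg.
split=> [x Ux|v].
  rewrite /prop_for/continuous_at -(fg _ Ux).
  by apply: cvg_trans (fc _ Ux); apply: near_eq_cvg; apply: near_fg.
have [dv cv] := fd v; split.
  by move=> x Ux; apply: near_eq_derivable (dv _ Ux); apply: near_fg.
by apply: IH cv => x Ux; apply: near_eq_derive; apply: near_fg.
Qed.

Lemma smooth_on_continuous E F (U : set E) (f : E -> F) x :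
  smooth_on U f -> U x -> {for x, continuous f}.
Proof. by move=> /(_ 0%N) [fc _]; apply: fc. Qed.

Lemma smooth_on_derivable E F (U : set E) (f : E -> F) v x :
  smooth_on U f -> U x -> derivable f x v.
Proof. by move=> /(_ 1%N) [_ /(_ v) [fd _]]; apply: fd. Qed.

Lemma smooth_on_derive E F (U : set E) (f : E -> F) v :
  smooth_on U f -> smooth_on U (fun x => 'D_v f x).
Proof. by move=> fs k; have [_ /(_ v) []] := fs k.+1. Qed.

Lemma mx_continuousP (T : topologicalType) m n (f : T -> 'M[R]_(m, n)) x :
  {for x, continuous f} <-> forall i j, {for x, continuous (fun y => f y i j)}.
Proof.
split=> [fc i j|fc].
  by apply: (@continuous_comp _ _ _ f (fun M : 'M[R]_(m, n) => M i j)) => //;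
     apply: coord_continuous.
apply/cvgrPdist_le => e e0; near=> y.
rewrite /Num.Def.normr /= mx_normrE (bigmax_le _ (ltW e0)) // => -[i j] _.
rewrite !mxE /=; move: (i) (j); near: y.
apply: filter_forall => i'; apply: filter_forall => j'.
by have /cvgrPdist_le := fc i' j'; apply.
Unshelve. all: by end_near. Qed.

Lemma Ck_on_mxP k E m n (U : set E) (f : E -> 'M[R]_(m, n)) : open U ->
  Ck_on k U f <-> forall i j, Ck_on k U (fun x => f x i j).
Proof.
move=> oU; elim: k f => [|k IH] f /=.
  split=> [[fc _] i j|fc]; split=> // x Ux.
    by have /mx_continuousP := fc _ Ux; apply.
  by apply/mx_continuousP => i j; have [/(_ _ Ux)] := fc i j.
split=> [[fc fd] i j|fc].
  split=> [x Ux|v]; first by have /mx_continuousP := fc _ Ux; apply.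
  have [dv cv] := fd v; split=> [x Ux|].
    by have /derivable_mxP := dv _ Ux; apply.
  have /IH/(_ i j) := cv; apply: Ck_on_eq => // x Ux.
  by rewrite derive_mx ?mxE//; apply: dv.
split=> [x Ux|v].
  by apply/mx_continuousP => i j; have [/(_ _ Ux)] := fc i j.
have dv x : U x -> derivable f x v.
  by move=> Ux; apply/derivable_mxP => i j; have [_ /(_ v) [+ _]] := fc i j; apply.
split=> //; apply/IH => i j; have [_ /(_ v) [_]] := fc i j.
by apply: Ck_on_eq => // x Ux; rewrite derive_mx ?mxE//; apply: dv.
Qed.

Lemma smooth_on_mxP E m n (U : set E) (f : E -> 'M[R]_(m, n)) : open U ->
  smooth_on U f <-> forall i j, smooth_on U (fun x => f x i j).
Proof.
move=> oU; split=> [fs i j k|fs k]; first exact: ((Ck_on_mxP k f oU).1 (fs k)).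
by apply/Ck_on_mxP => // i j; apply: fs.
Qed.

(** Products and inverses of smooth functions are best handled together: the class
    they generate is stable under each 'D_v, which a single order of
    differentiability is not, and this makes the induction of
    [smooth_alg_smooth] go through. *)
Inductive smooth_alg E (U : set E) : (E -> R) -> Prop :=
| smooth_alg_base f : smooth_on U f -> smooth_alg U f
| smooth_alg_add f g : smooth_alg U f -> smooth_alg U g ->
    smooth_alg U (fun x => f x + g x)
| smooth_alg_mul f g : smooth_alg U f -> smooth_alg U g ->
    smooth_alg U (fun x => f x * g x)
| smooth_alg_inv f : smooth_alg U f -> (forall x, U x -> f x != 0) ->
    smooth_alg U (fun x => (f x)^-1).

Lemma Ck_on_cst k E F (U : set E) (c : F) : Ck_on k U (fun _ => c).
Proof.
have cc (d : F) : forall x : E, U x -> {for x, continuous (fun=> d)}.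
  by move=> x _; apply: cvg_cst.
elim: k c => [|k IH] c /=; first by split=> //; apply: cc.
split=> [|v]; first exact: cc.
split=> [x Ux|]; first exact: derivable_cst.
suff -> : (fun x => 'D_v (fun=> c) x) = fun=> 0 by apply: IH.
by apply/funext => x; exact: derive_cst.
Qed.

Lemma smooth_on_cst E F (U : set E) (c : F) : smooth_on U (fun _ => c).
Proof. by move=> k; apply: Ck_on_cst. Qed.

Lemma smooth_alg_continuous E (U : set E) (f : E -> R) :
  smooth_alg U f -> forall x, U x -> {for x, continuous f}.
Proof.
elim=> {f} [f fs|f g _ fc _ gc|f g _ fc _ gc|f _ fc f0] x Ux.
- exact: smooth_on_continuous fs Ux.
- by apply: cvgD; [apply: fc|apply: gc].
- by apply: cvgM; [apply: fc|apply: gc].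
- by apply: cvgV; [apply: f0|apply: fc].
Qed.

Lemma smooth_alg_derive E (U : set E) (f : E -> R) v : smooth_alg U f ->
  (forall x, U x -> derivable f x v) /\
  exists2 g, smooth_alg U g & forall x, U x -> g x = 'D_v f x.
Proof.
elim=> {f} [f fs|f g fa [df [f' fa' ff']] ga [dg [g' ga' gg']]
  |f g fa [df [f' fa' ff']] ga [dg [g' ga' gg']]|f fa [df [f' fa' ff']] f0].
- split=> [x Ux|]; first exact: smooth_on_derivable fs Ux.
  by exists (fun x => 'D_v f x) => //; apply/smooth_alg_base/smooth_on_derive.
- split=> [x Ux|]; first by apply: derivableD; [apply: df|apply: dg].
  exists (fun x => f' x + g' x) => [|x Ux]; first exact: smooth_alg_add.
  by rewrite [RHS]deriveD ?ff' ?gg'//; [apply: df|apply: dg].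
- split=> [x Ux|]; first by apply: derivableM; [apply: df|apply: dg].
  exists (fun x => f x * g' x + g x * f' x) => [|x Ux].
    by apply: smooth_alg_add; apply: smooth_alg_mul.
  by rewrite [RHS]deriveM ?ff' ?gg'//; [apply: df|apply: dg].
- split=> [x Ux|]; first by apply: derivableV; [apply: f0|apply: df].
  exists (fun x => (-1) * ((f x)^-1 * (f x)^-1) * f' x) => [|x Ux].
    have fi := smooth_alg_inv fa f0.
    apply: smooth_alg_mul => //; apply: smooth_alg_mul; last exact: smooth_alg_mul.
    by apply: smooth_alg_base; apply: smooth_on_cst.
  rewrite deriveV ?f0 ?ff'//; last exact: df.
  by rewrite /GRing.scale /= mulN1r -invfM -expr2.
Qed.

Lemma smooth_alg_smooth E (U : set E) (f : E -> R) :
  open U -> smooth_alg U f -> smooth_on U f.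
Proof.
move=> oU fa k; elim: k f fa => [|k IH] f fa /=.
  by split=> // x Ux; apply: smooth_alg_continuous fa _ Ux.
split=> [x Ux|v]; first exact: smooth_alg_continuous fa _ Ux.
have [df [g ga gf]] := smooth_alg_derive v fa.
by split=> //; apply: Ck_on_eq oU gf (IH _ ga).
Qed.

Lemma smooth_onD E (U : set E) (f g : E -> R) : open U ->
  smooth_on U f -> smooth_on U g -> smooth_on U (fun x => f x + g x).
Proof.
by move=> oU fs gs; apply: smooth_alg_smooth => //; apply: smooth_alg_add;
   apply: smooth_alg_base.
Qed.

Lemma smooth_onM E (U : set E) (f g : E -> R) : open U ->
  smooth_on U f -> smooth_on U g -> smooth_on U (fun x => f x * g x).
Proof.
by move=> oU fs gs; apply: smooth_alg_smooth => //; apply: smooth_alg_mul;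
   apply: smooth_alg_base.
Qed.

Lemma smooth_onV E (U : set E) (f : E -> R) : open U ->
  smooth_on U f -> (forall x, U x -> f x != 0) -> smooth_on U (fun x => (f x)^-1).
Proof.
by move=> oU fs f0; apply: smooth_alg_smooth => //; apply: smooth_alg_inv => //;
   apply: smooth_alg_base.
Qed.

Lemma smooth_on_sum E (U : set E) I (r : seq I) (P : pred I) (f : I -> E -> R) :
  open U -> (forall i, P i -> smooth_on U (f i)) ->
  smooth_on U (fun x => \sum_(i <- r | P i) f i x).
Proof.
move=> oU fs; elim: r => [|i r IH].
  by under [X in smooth_on _ X]funext do rewrite big_nil; exact: smooth_on_cst.
under [X in smooth_on _ X]funext do rewrite big_cons.
by case: (boolP (P i)) => // Pi; apply: smooth_onD => //; apply: fs.
Qed.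

Lemma smooth_on_prod E (U : set E) I (r : seq I) (P : pred I) (f : I -> E -> R) :
  open U -> (forall i, P i -> smooth_on U (f i)) ->
  smooth_on U (fun x => \prod_(i <- r | P i) f i x).
Proof.
move=> oU fs; elim: r => [|i r IH].
  by under [X in smooth_on _ X]funext do rewrite big_nil; exact: smooth_on_cst.
under [X in smooth_on _ X]funext do rewrite big_cons.
by case: (boolP (P i)) => // Pi; apply: smooth_onM => //; apply: fs.
Qed.

Lemma smooth_on_coord p q (U : set 'M[R]_(p, q)) i j :
  smooth_on U (fun x => x i j).
Proof.
have dv (v x : 'M[R]_(p, q)) :
    is_derive x v (fun y : 'M[R]_(p, q) => y i j : R) (v i j).
  have di : derivable (id : 'M[R]_(p, q) -> _) x v by apply: derivable_id.
  split; first by have /derivable_mxP := di; apply.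
  by have := derive_mx di; rewrite derive_id => /matrixP/(_ i j); rewrite mxE.
have cc x : U x -> {for x, continuous (fun y : 'M[R]_(p, q) => y i j : R)}.
  by move=> _; apply: coord_continuous.
case=> [|k] /=; first by split.
split=> [//|v].
split=> [x Ux|]; first by case: (dv v x).
suff -> : (fun x => 'D_v (fun y : 'M[R]_(p, q) => y i j : R) x) = fun=> v i j.
  exact: Ck_on_cst.
by apply/funext => x; apply: derive_val.
Qed.

Lemma smooth_on_det E n (U : set E) (f : E -> 'M[R]_n) : open U ->
  (forall i j, smooth_on U (fun x => f x i j)) ->
  smooth_on U (fun x => \det (f x)).
Proof.
move=> oU fs; apply: smooth_on_sum => // s _.
apply: smooth_onM => //; first exact: smooth_on_cst.
by apply: smooth_on_prod => // i _; apply: fs.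
Qed.

(** Cramer's rule makes the entries of the inverse rational in the entries. *)
Lemma smooth_on_invmx E n (U : set E) (f : E -> 'M[R]_n) i j : open U ->
  (forall k l, smooth_on U (fun x => f x k l)) ->
  (forall x, U x -> f x \in unitmx) ->
  smooth_on U (fun x => invmx (f x) i j).
Proof.
move=> oU fs fu k.
apply: (@Ck_on_eq _ _ _ _ (fun x => (\det (f x))^-1 * cofactor (f x) j i)) => //.
  by move=> x Ux; rewrite /invmx fu // !mxE.
apply: smooth_onM => //.
  apply: smooth_onV => //; first exact: smooth_on_det.
  by move=> x /fu; rewrite unitmxE unitfE.
apply: smooth_onM => //; first exact: smooth_on_cst.
apply: smooth_on_det => // k' l'.
by under [X in smooth_on _ X]funext do rewrite !mxE; apply: fs.
Qed.

End SmoothFunctions.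

(** * Strict differentiability of C1 maps *)

Section Differentiability.
Context {R : realType}.
Implicit Types E F : normedModType R.

(** The epsilon form of differentiability, which also identifies the
    differential. *)
Lemma diff_of_estimate E F (f : E -> F) (L : {linear E -> F}) x :
  continuous L ->
  (forall e : R, 0 < e -> \forall h \near 0, `|f (x + h) - f x - L h| <= e * `|h|) ->
  differentiable f x /\ 'd f x = L :> (E -> F).
Proof.
move=> Lc fL.
have fo : f \o shift x = cst (f x) + L +o_ 0 id.
  apply/eqaddoP => _/posnumP[e]; have := fL e%:num (ltac:(by [])).
  apply: filterS => h; rewrite -[(_ - _) h]/(f (h + x) - (f x + L h)).
  by rewrite opprD addrA [h + x]addrC.
have dE := diff_unique Lc fo; split=> //.
by apply/diff_locallyP; rewrite dE.
Qed.

Lemma segment_mvt_pos E (f : E -> R) w e (t : R) : 0 <= t ->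
  (forall s, 0 <= s <= t -> derivable f (w + s *: e) e) ->
  exists2 s, 0 <= s <= t & f (w + t *: e) - f w = t * 'D_e f (w + s *: e).
Proof.
move=> t0 df; pose g (s : R) := f (w + s *: e).
have quot s : (fun h : R => h^-1 *: ((g \o shift s) (h *: (1 : R)) - g s)) =
    (fun h => h^-1 *: ((f \o shift (w + s *: e)) (h *: e) - f (w + s *: e))).
  apply/funext => h; rewrite /g /=; congr (_ *: (f _ - _)).
  by rewrite [h%:A]mulr1 scalerDl addrCA.
have dg s : 0 <= s <= t -> is_derive s 1 g ('D_e f (w + s *: e)).
  move=> st; split; first by rewrite /derivable quot; apply: df.
  by rewrite /derive quot.
have [||s] := @MVT_segment R g (fun s => 'D_e f (w + s *: e)) 0 t t0.
- by move=> s; rewrite in_itv /= => /andP[s0 st]; apply: dg; rewrite !ltW.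
- apply: derivable_within_continuous => s; rewrite in_itv /= => /dg dgs.
  exact: ex_derive.
- by rewrite in_itv /g /= scale0r addr0 subr0 mulrC => st; exists s.
Qed.

(** The mean value theorem for a displacement of either sign along one direction. *)
Lemma segment_mvt E (f : E -> R) w e (t : R) :
  (forall s, `|s| <= `|t| -> derivable f (w + s *: e) e) ->
  exists2 s, `|s| <= `|t| & f (w + t *: e) - f w = t * 'D_e f (w + s *: e).
Proof.
move=> df; have [t0|/ltW t0] := leP 0 t.
  have [s st|s /andP[s0 st] ->] := segment_mvt_pos t0 (w := w) (f := f) (e := e).
    by apply: df; case/andP: st => s0 st; rewrite !ger0_norm.
  by exists s => //; rewrite !ger0_norm.
have nt0 : 0 <= - t by rewrite oppr_ge0.
have [s|s /andP[s0 st]] := segment_mvt_pos nt0 (w := w + t *: e) (f := f) (e := e).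
  move=> /andP[s0 st]; rewrite -addrA -scalerDl; apply: df.
  by rewrite !ler0_norm// -?lerBrDl ?sub0r // opprD lerBlDl lerDr.
rewrite scaleNr addrK mulNr -[w + _ + _]addrA -scalerDl => fE.
exists (t + s); last by rewrite -[LHS]opprB fE opprK.
by rewrite !ler0_norm// -?lerBrDl ?sub0r // opprD lerBlDl lerDr.
Qed.

Section Coordinates.
Variables (p q : nat) (F : normedModType R) (D : 'I_p * 'I_q -> F).

Definition lin_of_coords (h : 'M[R]_(p, q)) : F := \sum_ij h ij.1 ij.2 *: D ij.

Lemma lin_of_coords_is_linear : linear lin_of_coords.
Proof.
move=> a u v; rewrite /lin_of_coords scaler_sumr -big_split /=.
by apply: eq_bigr => ij _; rewrite !mxE scalerDl scalerA.
Qed.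

HB.instance Definition _ :=
  GRing.isLinear.Build R 'M[R]_(p, q) F _ lin_of_coords lin_of_coords_is_linear.

Lemma lin_of_coords_continuous : continuous lin_of_coords.
Proof.
have -> : lin_of_coords = \sum_ij (fun h : 'M[R]_(p, q) => h ij.1 ij.2 *: D ij).
  by apply/funext => h; rewrite fct_sumE.
apply: (big_ind (fun g : 'M[R]_(p, q) -> F => continuous g)).
- by move=> x; apply: (@cst_continuous _ _ 0).
- by move=> f g fc gc x; apply: (@continuousD _ _ _ f g x); [exact: fc|exact: gc].
- by move=> ij _ x; apply: continuousZr_tmp; apply: coord_continuous.
Qed.

End Coordinates.

Lemma linear_mx_continuous p q F (L : {linear 'M[R]_(p, q) -> F}) : continuous L.
Proof.
have -> : (L : _ -> _) = lin_of_coords (fun ij => L (delta_mx ij.1 ij.2)).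
  apply/funext => h; rewrite {1}[h]matrix_sum_delta pair_bigA linear_sum /=.
  by apply: eq_bigr => ij _; rewrite linearZ.
exact: lin_of_coords_continuous.
Qed.

Lemma mx_norm_entry p q (x : 'M[R]_(p, q)) i j : `|x i j| <= `|x|.
Proof.
by rewrite [leRHS]/Num.Def.normr /= mx_normrE; apply: (le_bigmax _ _ (i, j)).
Qed.

Lemma mx_norm_le p q (x : 'M[R]_(p, q)) a :
  0 <= a -> (forall i j, `|x i j| <= a) -> `|x| <= a.
Proof.
by move=> a0 xa; rewrite /Num.Def.normr /= mx_normrE bigmax_le.
Qed.

(** Go from y to z one coordinate at a time and apply the mean value theorem to
    each step: every partial derivative met on the way is close to its value at
    x.  Both endpoints vary, which is what makes the estimate strict. *)
Lemma scalar_strict_diff p q (U : set 'M[R]_(p, q)) (f : 'M[R]_(p, q) -> R) x :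
  open U -> U x -> Ck_on 1 U f -> forall e, 0 < e ->
  exists2 d, 0 < d & forall y z, `|y - x| < d -> `|z - x| < d ->
   `|f z - f y - \sum_ij (z - y) ij.1 ij.2 *: 'D_(delta_mx ij.1 ij.2) f x|
     <= e * `|z - y|.
Proof.
move=> oU Ux [fc fd] e e0.
pose N : R := (#|{: 'I_p * 'I_q}|)%:R.
pose e' := e / (N + 1).
have N0 : 0 <= N by rewrite ler0n.
have e'0 : 0 < e' by rewrite divr_gt0 // ltr_wpDl.
have [d0 d0gt dP] : exists2 d0, 0 < d0 & forall w, `|w - x| < d0 ->
    U w /\ forall ij, `|'D_(delta_mx ij.1 ij.2) f w -
                        'D_(delta_mx ij.1 ij.2) f x| <= e'.
  have : \forall w \near x, U w /\
     forall ij : 'I_p * 'I_q, `|'D_(delta_mx ij.1 ij.2) f w -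
                        'D_(delta_mx ij.1 ij.2) f x| <= e'.
    near=> w; split.
      by near: w; apply: open_nbhs_nbhs.
    near: w; apply: filter_forall => ij.
    have [_ [Dc _]] := fd (delta_mx ij.1 ij.2).
    have /cvgrPdist_le := Dc _ Ux.
    by move=> /(_ _ e'0); apply: filterS => w; rewrite distrC.
  move=> /nbhs_ballP[d0 /= d0gt sub]; exists d0 => // w wx; apply: sub.
  by rewrite -ball_normE /= distrC.
(* The factor M keeps all intermediate points of the path within d0 of x:
   they are reached from y in at most N + 1 steps, each of length at most |h|,
   which is bounded by 2 d0 / M. *)
pose M := 1 + 2 * (N + 1).
have M0 : 0 < M by rewrite ltr_wpDr // mulr_ge0 // addr_ge0.
exists (d0 / M) => [|y z yx zx]; first exact: divr_gt0.
set h := z - y.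
have hd : `|h| <= 2 * (d0 / M).
  rewrite /h -(subrKA x) (le_trans (ler_normD _ _)) // mulr_natl mulr2n.
  by rewrite lerD // ?[`|x - y|]distrC ltW.
pose S (s : seq ('I_p * 'I_q)) :=
  \sum_(ij <- s) h ij.1 ij.2 *: delta_mx ij.1 ij.2 : 'M[R]_(p, q).
have delta_norm i j : `|delta_mx i j : 'M[R]_(p, q)| <= 1.
  by apply: mx_norm_le => // i' j'; rewrite mxE; case: (_ && _); rewrite ?normr1 ?normr0.
have Snorm s : `|S s| <= (size s)%:R * `|h|.
  rewrite /S; elim: s => [|ij s IH]; first by rewrite big_nil normr0 mul0r.
  rewrite big_cons /= (le_trans (ler_normD _ _)) // -addn1 natrD mulrDl mul1r.
  rewrite addrC lerD // normrZ -[leRHS]mulr1 ler_pM //; exact: mx_norm_entry.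
have step s : (size s <= #|{: 'I_p * 'I_q}|)%N ->
   `|f (y + S s) - f y -
     \sum_(ij <- s) h ij.1 ij.2 *: 'D_(delta_mx ij.1 ij.2) f x| <=
     (size s)%:R * e' * `|h|.
  elim: s => [|ij s IH] sN.
    by rewrite /S !big_nil addr0 subrr subrr normr0 mul0r mul0r.
  have near_x t : `|t| <= `|h ij.1 ij.2| ->
      `|y + S s + t *: delta_mx ij.1 ij.2 - x| < d0.
    move=> th; rewrite addrAC [y + S s - x]addrAC -addrA.
    rewrite (le_lt_trans (ler_normD _ _)) //.
    have -> : d0 = d0 / M + (N + 1) * (2 * (d0 / M)).
      by rewrite /M; field; rewrite gt_eqF.
    rewrite ltr_leD //; apply: le_trans (_ : (N + 1) * `|h| <= _); last first.
      by rewrite ler_wpM2l // addr_ge0.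
    rewrite (le_trans (ler_normD _ _)) // mulrDl mul1r lerD //.
      rewrite (le_trans (Snorm _)) // ler_wpM2r // ler_nat.
      exact: leq_trans (leqnSn _) sN.
    rewrite normrZ -[leRHS]mulr1 ler_pM //.
    by rewrite (le_trans th) // mx_norm_entry.
  have [|t th ft] := @segment_mvt _ f (y + S s) (delta_mx ij.1 ij.2) (h ij.1 ij.2).
    move=> t th; have [Uw _] := dP _ (near_x _ th).
    by have [df _] := fd (delta_mx ij.1 ij.2); apply: df.
  have [_ Dw] := dP _ (near_x _ th).
  rewrite /S !big_cons -/(S s) [h _ _ *: delta_mx _ _ + _]addrC addrA.
  have -> : f (y + S s + h ij.1 ij.2 *: delta_mx ij.1 ij.2) - f y -
     (h ij.1 ij.2 *: 'D_(delta_mx ij.1 ij.2) f x +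
      \sum_(j <- s) h j.1 j.2 *: 'D_(delta_mx j.1 j.2) f x) =
     (f (y + S s + h ij.1 ij.2 *: delta_mx ij.1 ij.2) - f (y + S s) -
      h ij.1 ij.2 *: 'D_(delta_mx ij.1 ij.2) f x) +
     (f (y + S s) - f y -
      \sum_(j <- s) h j.1 j.2 *: 'D_(delta_mx j.1 j.2) f x) by ring.
  rewrite ft /GRing.scale /= -mulrBr (le_trans (ler_normD _ _)) //.
  rewrite -addn1 natrD 2!mulrDl mul1r addrC lerD //.
    by apply: IH; apply: leq_trans (leqnSn _) sN.
  by rewrite normrM mulrC ler_pM // mx_norm_entry.
have Sh : S (enum {: 'I_p * 'I_q}) = h.
  by rewrite /S big_enum [RHS]matrix_sum_delta pair_bigA.
have := step (enum {: 'I_p * 'I_q}); rewrite Sh -cardE big_enum leqnn.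
rewrite {1}/h [y + (z - y)]addrC subrK => /(_ isT) /le_trans; apply.
rewrite ler_wpM2r // -/N /e' mulrCA ger_pMr // ler_pdivrMr ?mul1r ?lerDl //.
exact: ltr_wpDl.
Unshelve. all: by end_near. Qed.

Lemma scalar_differentiable p q (U : set 'M[R]_(p, q)) (f : 'M[R]_(p, q) -> R) x :
  open U -> U x -> Ck_on 1 U f -> differentiable f x.
Proof.
move=> oU Ux fC.
suff [] : differentiable f x /\
  'd f x = lin_of_coords (fun ij => 'D_(delta_mx ij.1 ij.2) f x : R) :> (_ -> _) by [].
apply: diff_of_estimate => [|e e0]; first exact: lin_of_coords_continuous.
have [d d0 fd] := scalar_strict_diff oU Ux fC e0.
apply/nbhs_ballP; exists d => // h; rewrite -ball_normE /= sub0r normrN => hd.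
have := fd x (x + h); rewrite subrr normr0 [x + h - x]addrC addKr.
exact.
Qed.

Lemma C1_strict_diff p q m n (U : set 'M[R]_(p, q))
    (f : 'M[R]_(p, q) -> 'M[R]_(m, n)) x :
  open U -> U x -> Ck_on 1 U f ->
  differentiable f x /\
  forall e : R, 0 < e -> exists2 d, 0 < d &
    forall y z, `|y - x| < d -> `|z - x| < d ->
      `|f z - f y - 'd f x (z - y)| <= e * `|z - y|.
Proof.
move=> oU Ux fC; pose D ij := 'D_(delta_mx ij.1 ij.2) f x.
have df v : derivable f x v by have [_ /(_ v) [+ _]] := fC; apply.
have est e : 0 < e -> exists2 d, 0 < d &
    forall y z, `|y - x| < d -> `|z - x| < d ->
      `|f z - f y - lin_of_coords D (z - y)| <= e * `|z - y|.
  move=> e0.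
  have fkl kl : {d | 0 < d & forall y z, `|y - x| < d -> `|z - x| < d ->
   `|f z kl.1 kl.2 - f y kl.1 kl.2 - lin_of_coords D (z - y) kl.1 kl.2|
     <= e * `|z - y|}.
    apply: cid2; case: kl => k l /=.
    have /(Ck_on_mxP _ _ oU)/(_ k l) fklC := fC.
    have [d d0 fd] := scalar_strict_diff oU Ux fklC e0.
    exists d => // y z yx zx; have := fd y z yx zx; congr (`|_ - _| <= _).
    rewrite summxE; apply: eq_bigr => ij _; rewrite !mxE /D derive_mx ?mxE //.
  exists (\big[Num.min/1]_kl s2val (fkl kl)).
    by apply/bigmin_gtP; split=> // kl _; case: (fkl kl).
  move=> y z /bigmin_gtP[_ yx] /bigmin_gtP[_ zx].
  apply: mx_norm_le => [|k l]; first by rewrite mulr_ge0 // ltW.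
  have := s2valP' (fkl (k, l)) y z (yx (k, l) isT) (zx (k, l) isT).
  by rewrite !mxE.
have [dfx dE] : differentiable f x /\ 'd f x = lin_of_coords D :> (_ -> _).
  apply: diff_of_estimate => [|e e0]; first exact: lin_of_coords_continuous.
  have [d d0 fd] := est _ e0.
  apply/nbhs_ballP; exists d => // h; rewrite -ball_normE /= sub0r normrN => hd.
  have := fd x (x + h); rewrite subrr normr0 [x + h - x]addrC addKr.
  exact.
by split=> // e e0; rewrite dE; apply: est.
Qed.

End Differentiability.

(** * The inverse function theorem *)

Section InverseFunction.
Context {R : realType}.

(** If the derivatives of g at c are smooth functions of g c, as for an inverse map,
    then the derivative of f \o g is again a smooth function composed with g, so
    smoothness bootstraps by induction on the order. *)
Lemma smooth_on_autonomous_comp p q (F : normedModType R)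
    (U : set 'M[R]_(p, q)) (O : set F) (g : F -> 'M[R]_(p, q))
    (H : F -> 'M[R]_(p, q) -> 'M[R]_(p, q)) :
  open U -> open O -> (forall c, O c -> U (g c)) ->
  (forall c, O c -> differentiable g c) ->
  (forall w c, O c -> 'D_w g c = H w (g c)) ->
  (forall w i j, smooth_on U (fun x => H w x i j)) ->
  forall f : 'M[R]_(p, q) -> R, smooth_on U f -> smooth_on O (f \o g).
Proof.
move=> oU oO gU dg Dg Hs f fs k.
elim: k f fs => [|k IH] f fs /=.
  split=> // c Oc; apply: continuous_comp; first exact/differentiable_continuous/dg.
  exact: smooth_on_continuous fs (gU _ Oc).
have df c : O c -> differentiable f (g c).
  by move=> Oc; apply: scalar_differentiable oU (gU _ Oc) (fs 1%N).
split=> [c Oc|w].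
  apply: continuous_comp; first exact/differentiable_continuous/dg.
  exact: smooth_on_continuous fs (gU _ Oc).
split=> [c Oc|].
  by apply: diff_derivable; apply: differentiable_comp; [exact: dg|exact: df].
pose f' x := \sum_ij H w x ij.1 ij.2 * 'D_(delta_mx ij.1 ij.2) f x.
have f's : smooth_on U f'.
  apply: smooth_on_sum => // ij _; apply: smooth_onM => //.
  exact: smooth_on_derive.
apply: (@Ck_on_eq _ _ _ _ _ (f' \o g)) (IH _ f's) => // c Oc /=.
rewrite deriveE; last by apply: differentiable_comp; [exact: dg|exact: df].
rewrite diff_comp /=; [|exact: dg|exact: df].
rewrite -[X in _ = 'd f _ X]deriveE; last exact: dg.
rewrite Dg // [H w (g c) in RHS]matrix_sum_delta pair_bigA linear_sum /f' /=.
apply: eq_bigr => ij _; rewrite deriveE; last exact: df.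
by rewrite linearZ.
Qed.

(** The matrix of the differential in the coordinates given by mxvec, acting on
    row vectors. *)
Definition jac p q n (f : 'M[R]_(p, q) -> 'rV[R]_n) x : 'M[R]_(p * q, n) :=
  lin1_mx ('d f x \o vec_mx).

Lemma mul_mxvec_jac p q n (f : 'M[R]_(p, q) -> 'rV[R]_n) x h :
  mxvec h *m jac f x = 'd f x h.
Proof. by rewrite /jac mul_rV_lin1 /= mxvecK. Qed.

Lemma jac_entry p q n (f : 'M[R]_(p, q) -> 'rV[R]_n) x i j :
  differentiable f x -> jac f x i j = 'D_(vec_mx (delta_mx 0 i)) f x 0 j.
Proof. by move=> df; rewrite deriveE // mxE /=. Qed.

Lemma linear_mx_bounded p q (F : normedModType R)
    (L : {linear 'M[R]_(p, q) -> F}) :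
  exists2 K, 0 < K & forall h, `|L h| <= K * `|h|.
Proof. by apply: linear_lipschitz; apply: linear_mx_continuous. Qed.

(* Banach's fixed point theorem needs norm and completeness in one structure. *)
HB.instance Definition _ p q := NormedModule.on 'M[R]_(p, q).

(** Solve f z = c by Newton's method with the derivative frozen: the map
    z - L (f z - c) contracts the closed ball around y by a factor 1/2, and L
    injective turns its fixed point into a solution. *)
Lemma contraction_surj p q (f : 'M[R]_(p, q) -> 'rV[R]_(p * q))
    (L : {linear 'rV[R]_(p * q) -> 'M[R]_(p, q)}) K y r c :
  0 < K -> (forall w, `|L w| <= K * `|w|) -> (forall w, L w = 0 -> w = 0) ->
  0 < r ->
  (forall z z', `|z - y| <= r -> `|z' - y| <= r ->
     `|L (f z - f z') - (z - z')| <= 2^-1 * `|z - z'|) ->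
  `|c - f y| <= r / (2 * K) ->
  exists2 z, `|z - y| <= r & f z = c.
Proof.
move=> K0 LK Linj r0 est cy.
pose T z := z - L (f z - c).
pose B := [set z : 'M[R]_(p, q) | `|z - y| <= r].
have TT z z' : B z -> B z' -> `|T z - T z'| <= 2^-1 * `|z - z'|.
  move=> Bz Bz'; have -> : T z - T z' = - (L (f z - f z') - (z - z')).
    have -> : L (f z - f z') = L (f z - c) - L (f z' - c).
      by rewrite -linearB opprB addrA subrK.
    rewrite /T; move: (L (f z - c)) (L (f z' - c)) => a b.
    by rewrite !opprB addrACA [RHS]addrACA [- a - z']addrC.
  by rewrite normrN; apply: est.
have TB : {homo T : z / B z >-> B z}.
  move=> z Bz; rewrite /B /= -(subrKA (T y)) (le_trans (ler_normD _ _)) //.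
  have By : B y by rewrite /B /= subrr normr0 ltW.
  rewrite [leRHS](splitr r) lerD //.
    rewrite (le_trans (TT _ _ Bz By)) // mulrC ler_wpM2r //.
  rewrite /T addrAC subrr add0r -linearN opprB (le_trans (LK _)) //.
  by rewrite -ler_pdivlMl // (le_trans cy) // invfM mulrA mulrC.
have [|||z Bz] := @banach_fixed_point _ _ B (mkfun TB).
- exists (2^-1)%:nng; split; first by rewrite /= invf_lt1 // ltr1n.
  by move=> [z z'] [/= Bz Bz']; apply: TT.
- have -> : B = closed_ball y r.
    by rewrite closed_ballE // /closed_ball_; apply/seteqP; split=> z /=;
      rewrite distrC.
  exact: closed_ball_closed.
- by exists y; rewrite /B /= subrr normr0 ltW.
move=> /eqP; rewrite /mkfun /T eq_sym -subr_eq0 addrAC subrr add0r oppr_eq0.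
by move=> /eqP/Linj/eqP; rewrite subr_eq0 => /eqP ?; exists z.
Qed.


Lemma ball_norm_nbhs (E : normedModType R) (x : E) (A : set E) :
  nbhs x A <-> exists2 d : R, 0 < d & forall y, `|y - x| < d -> A y.
Proof.
split=> [/nbhs_ballP[d /= d0 dA]|[d d0 dA]].
  by exists d => // y yx; apply: dA; rewrite -ball_normE /= distrC.
by apply/nbhs_ballP; exists d => // y; rewrite -ball_normE /= distrC; apply: dA.
Qed.

(** On a small ball f is close to its differential L^-1 at x0: the map L \o f - id
    is 1/2-Lipschitz.  So f is
    bi-Lipschitz there and [contraction_surj] shows that it is open.  Its inverse
    g satisfies 'D_w g c = w *m (jac f (g c))^-1 up to vec_mx, hence is smooth by
    [smooth_on_autonomous_comp]. *)
Theorem inverse_function p q (U0 : set 'M[R]_(p, q))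
    (f : 'M[R]_(p, q) -> 'rV[R]_(p * q)) x0 :
  open U0 -> U0 x0 -> smooth_on U0 f -> (forall h, 'd f x0 h = 0 -> h = 0) ->
  exists U g, [/\ open U /\ U x0, U `<=` U0, open (f @` U),
    smooth_on (f @` U) g & forall x, U x -> g (f x) = x].
Proof.
move=> oU0 U0x0 fs dinj.
have df x : U0 x -> differentiable f x.
  by move=> Ux; have [] := C1_strict_diff oU0 Ux (fs 1%N).
have Js i j : smooth_on U0 (fun x => jac f x i j).
  move=> k; apply: (@Ck_on_eq _ _ _ _ _
      (fun x => 'D_(vec_mx (delta_mx 0 i)) f x 0 j)) => //.
    by move=> x Ux; rewrite jac_entry //; apply: df.
  have /(smooth_on_mxP _ oU0) := smooth_on_derive (vec_mx (delta_mx 0 i)) fs.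
  exact.
have unit_inj n (A : 'M[R]_n) : (forall u : 'rV_n, u *m A = 0 -> u = 0) -> A \in unitmx.
  move=> Ai; rewrite -row_free_unit -kermx_eq0; apply/eqP/row_matrixP => i.
  by rewrite row0; apply: Ai; rewrite -row_mul mulmx_ker row0.
have J0 : jac f x0 \in unitmx.
  apply: unit_inj => u; rewrite -[u]vec_mxK mul_mxvec_jac => /dinj ->.
  by rewrite linear0.
pose L : {linear 'rV[R]_(p * q) -> 'M[R]_(p, q)} :=
  vec_mx \o mulmxr (invmx (jac f x0)).
have Ldf h : L ('d f x0 h) = h.
  by rewrite /L /= -mul_mxvec_jac mulmxK // mxvecK.
have Linj w : L w = 0 -> w = 0.
  move=> /(congr1 mxvec); rewrite vec_mxK linear0 => /(congr1 (mulmxr (jac f x0))).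
  by rewrite /= mulmxKV // mul0mx.
have [K K0 LK] := linear_mx_bounded L.
(* The differential has to stay invertible for the derivative of the inverse. *)
pose V := U0 `&` [set x | \det (jac f x) != 0].
have [d [d0 dV est]] : exists d, [/\ 0 < d, forall x, `|x - x0| < d -> V x &
    forall z z', `|z - x0| < d -> `|z' - x0| < d ->
      `|L (f z - f z') - (z - z')| <= 2^-1 * `|z - z'|].
  have /ball_norm_nbhs[d1 d10 d1V] : nbhs x0 V.
    apply: filterI; first exact: open_nbhs_nbhs.
    have /(_ _ U0x0) detc : forall x, U0 x ->
        {for x, continuous (fun x => \det (jac f x))}.
      by move=> x; apply: smooth_on_continuous; apply: smooth_on_det.
    apply: (detc [set t | t != 0]); apply: open_nbhs_nbhs; split=> /=.
      by have := @open_neq R 0.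
    by rewrite -unitfE -unitmxE.
  have [|d2 d20 d2P] := (C1_strict_diff oU0 U0x0 (fs 1%N)).2 (2 * K)^-1.
    by rewrite invr_gt0 mulr_gt0.
  exists (Num.min d1 d2); split=> [|x|z z']; first by rewrite lt_min d10.
    by rewrite lt_min => /andP[xd _]; apply: d1V.
  rewrite !lt_min => /andP[_ zd] /andP[_ z'd].
  rewrite -[z - z' in X in X <= _]Ldf -linearB (le_trans (LK _)) //.
  rewrite -ler_pdivlMl // (le_trans (d2P _ _ z'd zd)) //.
  by rewrite invfM mulrCA mulrA.
pose U := [set x | `|x - x0| < d].
have UV x : U x -> V x by exact: dV.
have UU0 x : U x -> U0 x by move=> /UV[].
have oU : open U.
  have -> : U = ball x0 d.
    by apply/seteqP; split=> z; rewrite -ball_normE /= /U /= distrC.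
  exact: ball_open.
have lower z z' : U z -> U z' -> `|z - z'| <= 2 * K * `|f z - f z'|.
  move=> Uz Uz'; rewrite -mulrA; apply: le_trans (_ : 2 * `|L (f z - f z')| <= _).
    have := ler_normD (z - z' - L (f z - f z')) (L (f z - f z')).
    have := est _ _ Uz Uz'; rewrite subrK distrC.
    by move: (`|_|) (`|_|) (`|_|) => a b c; lra.
  by rewrite ler_wpM2l.
have surj y : U y -> exists2 e : R, 0 < e & forall c, `|c - f y| < e ->
    exists2 z, U z & f z = c.
  move=> Uy; have /ball_norm_nbhs[r r0 rU] := open_nbhs_nbhs (conj oU Uy).
  have r20 : 0 < r / 2 by rewrite divr_gt0.
  have r2U z : `|z - y| <= r / 2 -> U z.
    by move=> zy; apply: rU; apply: le_lt_trans zy _; rewrite ltr_pdivrMr // ltr_pMr // ltr1n.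
  exists (r / 2 / (2 * K)); first by rewrite divr_gt0 // mulr_gt0.
  move=> c cy; have [|z zy fz] := @contraction_surj _ _ f L K y (r / 2) c K0 LK Linj r20 _ (ltW cy).
    by move=> z z' /r2U Uz /r2U Uz'; apply: est.
  by exists z => //; apply: r2U.
pose g c := get [set z | U z /\ f z = c].
have gP c : (f @` U) c -> U (g c) /\ f (g c) = c.
  by move=> [z Uz fz]; apply: (@getPex _ [set z | U z /\ f z = c]); exists z.
have gf x : U x -> g (f x) = x.
  move=> Ux; have [|Ug fg] := gP (f x); first by exists x.
  apply/eqP; rewrite -subr_eq0 -normr_le0 (le_trans (lower _ _ Ug Ux)) //.
  by rewrite fg subrr normr0 mulr0.
have ofU : open (f @` U).
  rewrite openE => c [y Uy <-]; have [e e0 eP] := surj _ Uy.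
  by apply/ball_norm_nbhs; exists e => // c' /eP[z Uz fz]; exists z.
have Ju x : U x -> jac f x \in unitmx.
  by move=> /UV[_ /= dn]; rewrite unitmxE unitfE.
have dg c : (f @` U) c -> differentiable g c /\
    'd g c = vec_mx \o mulmxr (invmx (jac f (g c))) :> (_ -> _).
  move=> fUc; have [Uy fy] := gP _ fUc; set y := g c in Uy fy *.
  pose M : {linear 'rV[R]_(p * q) -> 'M[R]_(p, q)} :=
    vec_mx \o mulmxr (invmx (jac f y)).
  have Mdf h : M ('d f y h) = h.
    by rewrite /M /= -mul_mxvec_jac mulmxK ?Ju // mxvecK.
  have [K' K'0 MK] := linear_mx_bounded M.
  apply: (@diff_of_estimate _ _ _ g M) => [|e e0]; first exact: linear_mx_continuous.
  have KK0 : 0 < 2 * K by rewrite mulr_gt0.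
  have e'0 : 0 < e / K' / (2 * K) by rewrite !divr_gt0.
  have [b b0 bP] := (C1_strict_diff oU0 (UU0 _ Uy) (fs 1%N)).2 _ e'0.
  have /ball_norm_nbhs[a a0 aP] := open_nbhs_nbhs (conj ofU fUc).
  apply/ball_norm_nbhs; exists (Num.min a (b / (2 * K))).
    by rewrite lt_min a0 divr_gt0.
  move=> h; rewrite subr0 lt_min => /andP[ha hb].
  have [|Uz fz] := gP (c + h); first by apply: aP; rewrite addrC addKr.
  set z := g (c + h) in Uz fz *.
  have zy : `|z - y| <= 2 * K * `|h|.
    by have := lower _ _ Uz Uy; rewrite fz fy [c + h]addrC addrK.
  have yb : `|z - y| < b.
    by apply: le_lt_trans zy _; rewrite -ltr_pdivlMl // mulrC.
  have := bP y z; rewrite subrr normr0 => /(_ b0 yb).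
  rewrite fz fy [c + h]addrC addrK => est2.
  rewrite -[z - y]Mdf -linearB (le_trans (MK _)) // -ler_pdivlMl //.
  rewrite distrC (le_trans est2) //.
  have -> : K'^-1 * (e * `|h|) = e / K' / (2 * K) * (2 * K * `|h|).
    by field; rewrite !gt_eqF.
  by rewrite ler_wpM2l // ltW.
exists U, g; split => //.
- by split=> //; rewrite /U /= subrr normr0.
apply/smooth_on_mxP => // i j.
pose H (w : 'rV[R]_(p * q)) x := vec_mx (w *m invmx (jac f x)) : 'M[R]_(p, q).
apply: (@smooth_on_autonomous_comp _ _ _ U _ g H _ _ _ _ _ _ (fun x => x i j)) => //.
- by move=> c /gP[].
- by move=> c /dg[].
- by move=> w c fUc; have [dgc dE] := dg _ fUc; rewrite deriveE // dE.
- move=> w k l; rewrite /H.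
  under [X in smooth_on _ X]funext do rewrite !mxE.
  apply: smooth_on_sum => // m _; apply: smooth_onM => //; first exact: smooth_on_cst.
  by apply: smooth_on_invmx => // k' l'; apply: smooth_on_sub (Js k' l').
- exact: smooth_on_coord.
Qed.

End InverseFunction.

(** * Dimension of submanifolds *)

Section Submanifolds.
Context {R : realType}.

(** The image of the smaller domain is open because it is the preimage of V under
    the continuous inverse chart. *)
Lemma slice_chart_open p q (S V : set 'M[R]_(p, q)) k U phi :
  open V -> slice_chart S k U phi -> slice_chart (S `&` V) k (U `&` V) phi.
Proof.
move=> oV [[oU ofU] sphi [psi spsi psiK] slice].
have img : phi @` (U `&` V) = phi @` U `&` psi @^-1` V.
  apply/seteqP; split=> [_ [x [Ux Vx] <-]|_ [[x Ux <-]]].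
    by split; [exists x|rewrite /= psiK].
  by rewrite /= psiK // => Vx; exists x.
have oimg : open (phi @` (U `&` V)).
  rewrite img openE => c [fUc Vc]; apply: filterI; first exact: open_nbhs_nbhs.
  by have := smooth_on_continuous spsi fUc; apply; apply: open_nbhs_nbhs.
split.
- by split=> //; apply: openI.
- by apply: smooth_on_sub sphi => x [].
- exists psi => [|x [Ux _]]; last exact: psiK.
  by apply: smooth_on_sub spsi; rewrite img => c [].
- apply/seteqP; split=> [_ [x [[Sx Vx] [Ux _]] <-]|_ [[x [Ux Vx] <-] /= x0]].
    split; first by exists x.
    have : (phi @` (S `&` U)) (phi x) by exists x.
    by rewrite slice => -[].
  have : (phi @` U `&` [set y : 'rV[R]_(p * q) |
       forall i : 'I_(p * q), (k <= i)%N -> y 0 i = 0]) (phi x).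
    by split=> //; exists x.
  rewrite -slice => -[x' [Sx' Ux'] xx'].
  have ? : x' = x by rewrite -(psiK _ Ux) -xx' psiK.
  by subst x'; exists x.
Qed.

Lemma smooth_submanifold_open p q k (S V : set 'M[R]_(p, q)) :
  open V -> smooth_submanifold k S -> smooth_submanifold k (S `&` V).
Proof.
move=> oV [kpq charts]; split=> // x [/charts[U [phi [Ux ch]]] Vx].
by exists (U `&` V), phi; split; [split|exact: slice_chart_open].
Qed.

Lemma diff_left_inverse_inj p q m n (U : set 'M[R]_(p, q))
    (phi : 'M[R]_(p, q) -> 'M[R]_(m, n)) psi x :
  open U -> U x -> (forall y, U y -> psi (phi y) = y) ->
  differentiable phi x -> differentiable psi (phi x) ->
  forall h, 'd psi (phi x) ('d phi x h) = h.
Proof.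
move=> oU Ux psiK dphi dpsi h.
rewrite -[LHS]/((('d psi (phi x)) \o ('d phi x)) h) -diff_comp //.
rewrite -deriveE; last exact: differentiable_comp.
rewrite -[RHS](derive_id x h); apply: near_eq_derive.
by apply: filterS (open_nbhs_nbhs (conj oU Ux)) => y /psiK.
Qed.

(** Let phi be a chart of M and chi a chart of S at the same point.  The
    differential of chi \o phi^-1 is injective and maps the first k coordinate
    directions into the span of the first l: curves in the slice of M are sent
    into M, hence into S, hence into the slice of S. *)
Lemma submanifold_dim_le p q k l (M S : set 'M[R]_(p, q)) :
  M !=set0 -> M `<=` S -> smooth_submanifold k M -> smooth_submanifold l S ->
  (k <= l)%N.
Proof.
move=> [x Mx] MS [kpq /(_ _ Mx)[U [phi [Ux [[oU ofU] sphi [psi spsi psiK] sl]]]]].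
move=> [lpq /(_ _ (MS _ Mx))[V [chi [Vx [[oV ofV] schi [xi sxi xiK] sl']]]]].
have dphi : differentiable phi x by case: (C1_strict_diff oU Ux (sphi 1%N)).
have fUx : (phi @` U) (phi x) by exists x.
have fVx : (chi @` V) (chi x) by exists x.
have dpsi : differentiable psi (phi x) by case: (C1_strict_diff ofU fUx (spsi 1%N)).
have dchi : differentiable chi x by case: (C1_strict_diff oV Vx (schi 1%N)).
have dxi : differentiable xi (chi x) by case: (C1_strict_diff ofV fVx (sxi 1%N)).
have phiK y : (phi @` U) y -> phi (psi y) = y by move=> [z Uz <-]; rewrite psiK.
have psix : psi (phi x) = x by apply: psiK.
have psi_inj h : 'd phi x ('d psi (phi x) h) = h.
  by have := diff_left_inverse_inj ofU fUx phiK dpsi; rewrite psix; apply.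
have chi_inj := diff_left_inverse_inj oV Vx xiK dchi dxi.
pose T : {linear 'rV[R]_(p * q) -> 'rV[R]_(p * q)} := 'd chi x \o 'd psi (phi x).
have Tinj w : T w = 0 -> w = 0.
  by move=> Tw; rewrite -(psi_inj w) -(chi_inj ('d psi _ w)) [X in 'd xi _ X]Tw !linear0.
have Tslice (w : 'rV[R]_(p * q)) (i : 'I_(p * q)) : (forall j : 'I_(p * q), (k <= j)%N -> w 0 j = 0) -> (l <= i)%N ->
    T w 0 i = 0.
  move=> wk li.
  have -> : T w 0 i = 'D_w (fun y => chi (psi y) 0 i) (phi x).
    have dcp : differentiable (chi \o psi) (phi x).
      by apply: differentiable_comp; rewrite ?psix.
    have dcpw : derivable (chi \o psi) (phi x) w by apply: diff_derivable.
    have := derive_mx dcpw => /matrixP/(_ 0 i).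
    by rewrite [RHS]mxE => <-; rewrite deriveE // diff_comp ?psix.
  have cst0 : {near (0 : R), (fun h : R => chi (psi (h *: w + phi x)) 0 i) =1 cst 0}.
    have lin : (fun h : R => h *: w + phi x) @ 0 --> phi x.
      rewrite -[X in _ --> X]add0r -(scale0r w).
      by apply: cvgD; [apply: cvgZr_tmp|apply: cvg_cst].
    have chiV : \forall h \near (0 : R), V (psi (h *: w + phi x)).
      have psic : {for phi x, continuous psi} by apply: differentiable_continuous.
      by apply: (cvg_comp _ _ lin psic); rewrite psix; apply: open_nbhs_nbhs.
    have fU : \forall h \near (0 : R), (phi @` U) (h *: w + phi x).
      by apply: lin; apply: open_nbhs_nbhs.
    near=> h.
    have fUh : (phi @` U) (h *: w + phi x) by near: h.
    have Vh : V (psi (h *: w + phi x)) by near: h.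
    have : (phi @` (M `&` U)) (h *: w + phi x).
      rewrite sl; split=> // j kj; rewrite !mxE wk // mulr0 add0r.
      have : (phi @` (M `&` U)) (phi x) by exists x.
      by rewrite sl => -[_]; apply.
    move=> [z [Mz Uz] zE].
    have : (chi @` (S `&` V)) (chi (psi (h *: w + phi x))).
      exists (psi (h *: w + phi x)) => //; split=> //.
      by rewrite -zE psiK //; apply: MS.
    by rewrite sl' => -[_]; apply.
  rewrite /derive; apply: cvg_lim => //.
  have c0 : chi (psi (phi x)) 0 i = 0.
    by have := nbhs_singleton cst0; rewrite scale0r add0r.
  apply: (@cvg_trans _ (cst 0 @ 0^')); last exact: cvg_cst.
  apply: near_eq_cvg; apply: cvg_within; near=> h => /=.
  have -> : chi (psi (h *: w + phi x)) 0 i = 0 by near: h.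
  by rewrite c0 subrr scaler0.
(* Row a of B is the image of the a-th coordinate direction: its rank is k, and it
   factors through l columns. *)
pose B : 'M[R]_(k, p * q) := \matrix_(a < k) T (delta_mx 0 (widen_ord kpq a)).
have TB (u : 'rV[R]_k) : u *m B = T (\sum_a u 0 a *: delta_mx 0 (widen_ord kpq a)).
  rewrite linear_sum mulmx_sum_row; apply: eq_bigr => a _.
  by rewrite linearZ rowK.
have Bfree : row_free B.
  rewrite -kermx_eq0; apply/eqP/row_matrixP => a; rewrite row0.
  have := TB (row a (kermx B)); rewrite -row_mul mulmx_ker row0 => /esym/Tinj E0.
  apply/rowP => b; have /rowP/(_ (widen_ord kpq b)) := E0.
  rewrite summxE (bigD1 b) //= big1 => [|c cb].
    by rewrite !mxE !eqxx mulr1 addr0.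
  rewrite !mxE eqxx /=; case: eqP => [/(congr1 val)/= bc|_]; last by rewrite mulr0.
  by rewrite (val_inj bc) eqxx in cb.
have BL : B = colsub (widen_ord lpq) B *m
    (\matrix_(a < l, b < p * q) (val a == val b)%:R).
  apply/matrixP => a b; rewrite [RHS]mxE.
  have [lb|lb] := leqP l b.
    rewrite [LHS]mxE Tslice // => [|j kj].
      rewrite big1 // => c _; rewrite !mxE; case: eqP => [cb|_]; last by rewrite mulr0.
      by have := ltn_ord c; rewrite cb ltnNge lb.
    rewrite mxE eqxx /=; case: eqP => // jE.
    by have := ltn_ord a; rewrite ltnNge; move: kj; rewrite jE /= => ->.
  rewrite (bigD1 (Ordinal lb)) //= big1 => [|c cb].
    rewrite addr0 [X in _ * X]mxE eqxx mulr1 [RHS]mxE; congr (B _ _).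
    exact: val_inj.
  rewrite [X in _ * X]mxE; case: eqP => [/= cb'|_]; last by rewrite mulr0.
  by case/eqP: cb; apply: val_inj.
have := Bfree; rewrite /row_free BL => /eqP Bk.
by rewrite -{1}Bk (leq_trans (mxrankM_maxl _ _)) // rank_leq_col.
Unshelve. all: by end_near. Qed.

Lemma sdim_ge p q k (M T : set 'M[R]_(p, q)) :
  M !=set0 -> M `<=` T -> smooth_submanifold k M -> k%:Z <= sdim T.
Proof.
move=> M0 MT sM; have kpq : (k < (p * q).+1)%N by case: sM.
apply: (@le_bigmax_cond _ _ _ _ (Ordinal kpq) _ (fun i : 'I_(p * q).+1 => i%:Z)).
by apply/asboolP; exists M.
Qed.

Lemma sdim_sandwich p q k (M T S : set 'M[R]_(p, q)) :
  M !=set0 -> M `<=` T -> T `<=` S ->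
  smooth_submanifold k M -> smooth_submanifold k S -> sdim T = k%:Z.
Proof.
move=> M0 MT TS sM sS; apply/eqP; rewrite eq_le; apply/andP; split.
  rewrite /sdim; apply/bigmax_leP; split=> [|i /asboolP[N [N0 NT sN]]].
    by rewrite (@le_trans _ _ 0).
  by rewrite lez_nat; apply: submanifold_dim_le N0 (subset_trans NT TS) sN sS.
exact: sdim_ge MT sM.
Qed.

End Submanifolds.

(** * Regular level sets *)

Section LevelSets.
Context {R : realType}.

(** Let K be a basis of the kernel of the differential of F at x0 and C a right
    inverse of K.  The map x |-> (x C, F x) has an injective differential at x0,
    so it is a chart; its last r coordinates are F, which makes it a slice chart
    of the level set at all points of its domain. *)
Theorem regular_level_set p q r (U0 : set 'M[R]_(p, q))
    (F : 'M[R]_(p, q) -> 'rV[R]_r) x0 :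
  open U0 -> U0 x0 -> smooth_on U0 F -> \rank (jac F x0) = r ->
  exists k U, [/\ (k + r = p * q)%N, open U /\ U x0, U `<=` U0 &
    smooth_submanifold k ([set x | F x = 0] `&` U)].
Proof.
move=> oU0 U0x0 Fs rF.
pose K := row_base (kermx (jac F x0)).
set k := \rank (kermx (jac F x0)) in K *.
have kr : (k + r = p * q)%N.
  by rewrite /k mxrank_ker rF subnK // -{1}rF rank_leq_row.
(* K is row free, so its pseudo-inverse is a right inverse. *)
pose C : 'M[R]_(p * q, k) := pinvmx K.
have KC : K *m C = 1%:M by rewrite mulmxVp // row_base_free.
have CF u : u *m C = 0 -> u *m jac F x0 = 0 -> u = 0.
  move=> uC /eqP uF; have /submxP[w uw] : (u <= K)%MS by rewrite eq_row_base; apply/sub_kermxP/eqP.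
  by move: uC; rewrite uw -mulmxA KC mulmx1 => ->; rewrite mul0mx.
pose phi x : 'rV[R]_(p * q) :=
  castmx (erefl, kr) (row_mx (mxvec x *m C) (F x)).
have lin_smooth a : smooth_on U0 (fun x => (mxvec x *m C) 0 a).
  under [X in smooth_on _ X]funext do rewrite mxE.
  apply: smooth_on_sum => // b _; apply: smooth_onM => //; last exact: smooth_on_cst.
  case/mxvec_indexP: b => b1 b2.
  under [X in smooth_on _ X]funext do rewrite mxvecE.
  exact: smooth_on_coord.
have phis : smooth_on U0 phi.
  apply/smooth_on_mxP => // i j; rewrite /phi.
  under [X in smooth_on _ X]funext do rewrite castmxE mxE.
  rewrite cast_ord_id ord1; case: splitP => a _ /=; first exact: lin_smooth.
  by have /(smooth_on_mxP _ oU0) := Fs; apply.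
have dF : differentiable F x0 by case: (C1_strict_diff oU0 U0x0 (Fs 1%N)).
have dphi : differentiable phi x0 by case: (C1_strict_diff oU0 U0x0 (phis 1%N)).
have phi_inj h : 'd phi x0 h = 0 -> h = 0.
  move=> dh0.
  suff /eqP : mxvec h = 0 by rewrite mxvec_eq0 => /eqP.
  have dphiE := derive_mx (diff_derivable (v := h) dphi).
  have dFE := derive_mx (diff_derivable (v := h) dF).
  rewrite deriveE // dh0 in dphiE.
  apply: CF; last first.
    rewrite mul_mxvec_jac -deriveE // dFE; apply/rowP => j.
    have /rowP/(_ (cast_ord kr (rshift k j))) := dphiE.
    rewrite !mxE => /esym; rewrite (_ : (fun t => phi t 0 _) = fun t => F t 0 j) //.
    by apply/funext => t; rewrite /phi castmxE /= cast_ord_id cast_ordK row_mxEr.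
  apply/rowP => j; have /rowP/(_ (cast_ord kr (lshift r j))) := dphiE.
  rewrite !mxE => /esym.
  pose L : {linear 'M[R]_(p, q) -> 'rV[R]_k} := mulmxr C \o mxvec.
  rewrite (_ : (fun t => phi t 0 _) = fun t => L t 0 j); last first.
    by apply/funext => t; rewrite /phi castmxE /= cast_ord_id cast_ordK row_mxEl.
  have Lc : continuous L by apply: linear_mx_continuous.
  have dL : differentiable L x0 by apply: linear_differentiable.
  have /matrixP/(_ 0 j) := derive_mx (diff_derivable (v := h) dL).
  by rewrite [X in _ = X -> _]mxE deriveE // diff_lin //= => <-; rewrite mxE.
have [U [psi [[oU Ux0] UU0 ofU psis psiK]]] := inverse_function oU0 U0x0 phis phi_inj.
exists k, U; split=> //; split; first by rewrite -kr leq_addr.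
move=> x [_ Ux]; exists U, phi; split=> //; split=> //.
- exact: smooth_on_sub phis.
- by exists psi.
rewrite -setIA setIid; apply/seteqP; split=> [_ [y [/= Fy Uy] <-]|_ [[y Uy <-] /= y0]].
  split=> [|i ki]; first by exists y.
  rewrite /phi castmxE Fy /= mxE; case: splitP => a /= iE; last by rewrite mxE.
  by have := ltn_ord a; rewrite -iE ltnNge ki.
exists y => //; split=> //=; apply/rowP => j; rewrite mxE.
have := y0 (cast_ord kr (rshift k j)); rewrite leq_addr => /(_ isT).
by rewrite /phi castmxE /= cast_ord_id cast_ordK row_mxEr.
Qed.

End LevelSets.

(** * Convex hulls and their faces *)

(* The convex hull of columns, not the convex combination of two points. *)
Local Notation conv := Defs.conv.

Section PolytopeGeometry.
Context {R : realType}.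

Lemma dotp_mulmx e m (A : 'M[R]_(e, m)) x j : dotp (col j A) x = (A^T *m x) j 0.
Proof. by rewrite /dotp !mxE; apply: eq_bigr => k _; rewrite !mxE. Qed.

Lemma dotpE e (c x : 'cV[R]_e) : dotp c x = \sum_k c k 0 * x k 0.
Proof. by rewrite /dotp !mxE; apply: eq_bigr => k _; rewrite !mxE. Qed.

Lemma dotpC e (c x : 'cV[R]_e) : dotp c x = dotp x c.
Proof. by rewrite !dotpE; apply: eq_bigr => k _; rewrite mulrC. Qed.

Lemma dotpDr e (c x y : 'cV[R]_e) : dotp c (x + y) = dotp c x + dotp c y.
Proof. by rewrite /dotp mulmxDr mxE. Qed.

Lemma dotpNr e (c x : 'cV[R]_e) : dotp c (- x) = - dotp c x.
Proof. by rewrite /dotp mulmxN mxE. Qed.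

Lemma dotpZr e (c x : 'cV[R]_e) a : dotp c (a *: x) = a * dotp c x.
Proof. by rewrite /dotp -scalemxAr mxE. Qed.

Lemma dotp0r e (c : 'cV[R]_e) : dotp c 0 = 0.
Proof. by rewrite /dotp mulmx0 mxE. Qed.

Lemma dotp_suml e I (r : seq I) (P : pred I) (c : I -> 'cV[R]_e) x :
  dotp (\sum_(i <- r | P i) c i) x = \sum_(i <- r | P i) dotp (c i) x.
Proof.
rewrite dotpC /dotp mulmx_sumr summxE; apply: eq_bigr => i _.
by rewrite -[LHS]/(dotp x (c i)) dotpC.
Qed.

Lemma mulmx_sum_col e n (V : 'M[R]_(e, n)) (l : 'cV[R]_n) :
  V *m l = \sum_i l i 0 *: col i V.
Proof.
apply/colP => k; rewrite !mxE summxE; apply: eq_bigr => i _.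
by rewrite !mxE mulrC.
Qed.

Lemma dotp_mul_col e n (c : 'cV[R]_e) (V : 'M[R]_(e, n)) (l : 'cV[R]_n) :
  dotp c (V *m l) = \sum_i l i 0 * dotp c (col i V).
Proof.
rewrite mulmx_sum_col /dotp mulmx_sumr summxE; apply: eq_bigr => i _.
by rewrite -dotpZr.
Qed.

(** Barycentric coordinates supported on I. *)
Definition weights n (I : {set 'I_n}) (l : 'cV[R]_n) : Prop :=
  [/\ forall i, 0 <= l i 0, \sum_i l i 0 = 1 & forall i, i \notin I -> l i 0 = 0].

Definition conv_on e n (V : 'M[R]_(e, n)) (I : {set 'I_n}) : set 'cV[R]_e :=
  [set x | exists2 l, weights I l & x = V *m l].

Definition verts e n (V : 'M[R]_(e, n)) (G : set 'cV[R]_e) : {set 'I_n} :=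
  [set i | `[< G (col i V) >]]%SET.

Lemma in_verts e n (V : 'M[R]_(e, n)) G i : (i \in verts V G) <-> G (col i V).
Proof. by rewrite inE; split=> /asboolP. Qed.

Lemma weights_delta n (I : {set 'I_n}) i : i \in I -> weights I (delta_mx i 0).
Proof.
move=> iI; split=> [j||j].
- by rewrite mxE; case: (_ && _).
- by rewrite (bigD1 i) //= big1 ?mxE ?eqxx ?addr0 // => j ji; rewrite mxE (negbTE ji).
- by move=> jI; rewrite mxE; case: eqP => // ji; rewrite ji iI in jI.
Qed.

Lemma conv_on_vertex e n (V : 'M[R]_(e, n)) (I : {set 'I_n}) i :
  i \in I -> conv_on V I (col i V).
Proof.
move=> iI; exists (delta_mx i 0); first exact: weights_delta.
by rewrite colE.
Qed.

Lemma conv_on_sub e n (V : 'M[R]_(e, n)) (I J : {set 'I_n}) :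
  I \subset J -> conv_on V I `<=` conv_on V J.
Proof.
move=> /fintype.subsetP IJ x [l [l0 l1 lI] ->]; exists l => //; split=> // i iJ.
by apply: lI; apply: contra iJ; apply: IJ.
Qed.

Lemma conv_onT e n (V : 'M[R]_(e, n)) : conv V = conv_on V [set: 'I_n]%SET.
Proof.
apply/seteqP; split=> [x [l [l0 l1 ->]]|x [l [l0 l1 _] ->]]; exists l => //.
by split=> // i; rewrite inE.
Qed.

Lemma conv_on_conv e n (V : 'M[R]_(e, n)) (I : {set 'I_n}) :
  conv_on V I `<=` conv V.
Proof. by rewrite conv_onT; apply: conv_on_sub; apply: finset.subsetT. Qed.

Lemma conv_vertex e n (V : 'M[R]_(e, n)) i : conv V (col i V).
Proof. by rewrite conv_onT; apply: conv_on_vertex; rewrite inE. Qed.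

Lemma weights_ex n (I : {set 'I_n}) (l : 'cV[R]_n) :
  weights I l -> exists2 i, i \in I & 0 < l i 0.
Proof.
move=> [l0 l1 lI]; apply: contrapT => noi.
have : \sum_i l i 0 <= 0.
  apply: sumr_le0 => i _; case: (boolP (i \in I)) => [iI|/lI->//].
  by rewrite leNgt; apply/negP => li; apply: noi; exists i.
by rewrite l1 leNgt ltr01.
Qed.

Lemma conv_on_set0 e n (V : 'M[R]_(e, n)) : conv_on V finset.set0 = set0.
Proof.
by apply/seteqP; split=> // x [l /weights_ex[i]]; rewrite inE.
Qed.

Lemma conv_on_set1 e n (V : 'M[R]_(e, n)) i : conv_on V [set i]%SET = [set col i V].
Proof.
apply/seteqP; split=> [x [l [l0 l1 lI] ->]|_ ->]; last first.
  by apply: conv_on_vertex; rewrite inE.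
have l0' k : k != i -> l k 0 = 0 by move=> ki; apply: lI; rewrite inE.
move: l1; rewrite (bigD1 i) //= big1 ?addr0 => [li|k /l0'//].
rewrite mulmx_sum_col (bigD1 i) //= big1 ?addr0 => [|k /l0'->].
  by rewrite li scale1r.
by rewrite scale0r.
Qed.

Lemma conv_convex e n (V : 'M[R]_(e, n)) x y s :
  conv V x -> conv V y -> 0 <= s -> s <= 1 -> conv V (s *: x + (1 - s) *: y).
Proof.
move=> [l [l0 l1 ->]] [k [k0 k1 ->]] s0 s1.
exists (s *: l + (1 - s) *: k); split.
- by move=> i; rewrite !mxE addr_ge0 // mulr_ge0 // subr_ge0.
- under eq_bigr do rewrite !mxE.
  by rewrite big_split /= -!mulr_sumr l1 k1 !mulr1 subrKC.
- by rewrite mulmxDr -!scalemxAr.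
Qed.

Lemma dotp_conv_le e n (V : 'M[R]_(e, n)) c b x :
  (forall i, dotp c (col i V) <= b) -> conv V x -> dotp c x <= b.
Proof.
move=> cb [l [l0 l1 ->]]; rewrite dotp_mul_col -[b]mul1r -l1 mulr_suml.
by apply: ler_sum => i _; rewrite ler_wpM2l.
Qed.

Lemma dotp_conv_on_eq e n (V : 'M[R]_(e, n)) (I : {set 'I_n}) c b x :
  (forall i, i \in I -> dotp c (col i V) = b) -> conv_on V I x -> dotp c x = b.
Proof.
move=> cb [l [l0 l1 lI] ->]; rewrite dotp_mul_col -[b]mul1r -l1 mulr_suml.
apply: eq_bigr => i _; case: (boolP (i \in I)) => [/cb->//|/lI->].
by rewrite !mul0r.
Qed.

(** A convex combination attains an upper bound of a linear form on the columns
    only if all columns carrying weight attain it. *)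
Lemma face_conv_on e n (V : 'M[R]_(e, n)) c b :
  (forall i, dotp c (col i V) <= b) ->
  conv V `&` [set x | dotp c x = b] =
    conv_on V [set i | dotp c (col i V) == b]%SET.
Proof.
move=> cb; apply/seteqP; split=> [x [[l [l0 l1 ->]] /= lb]|x xI]; last first.
  split; first exact: conv_on_conv xI.
  by apply: dotp_conv_on_eq xI => i; rewrite inE => /eqP.
exists l => //; split=> // i; rewrite inE => ib.
have ge0 k : 0 <= l k 0 * (b - dotp c (col k V)) by rewrite mulr_ge0 // subr_ge0.
have : \sum_k l k 0 * (b - dotp c (col k V)) = 0.
  under eq_bigr do rewrite mulrBr.
  by rewrite big_split /= sumrN -dotp_mul_col lb -mulr_suml l1 mul1r subrr.
move=> /eqP; rewrite psumr_eq0 // => /allP/(_ i); rewrite mem_index_enum => /(_ isT) /=.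
rewrite mulf_eq0 subr_eq0 [b == _]eq_sym (negbTE ib) orbF => /eqP.
exact.
Qed.

Lemma faceE e n (V : 'M[R]_(e, n)) G :
  face (conv V) G -> G = conv_on V (verts V G).
Proof.
move=> [c [b [cb GE]]].
have cb' i : dotp c (col i V) <= b by apply/cb/conv_vertex.
rewrite {1}GE face_conv_on //; congr conv_on.
apply/setP => i; rewrite inE; apply/eqP/idP => [ib|/in_verts].
  by apply/in_verts; rewrite GE; split=> //; apply: conv_vertex.
by rewrite GE => -[].
Qed.

End PolytopeGeometry.

(** * Faces read off from incidences *)

Section IncidencePatterns.
Context {R : realType} {n m : nat}.
Variable inc : 'I_n -> 'I_m -> bool.

(** A polytope with the origin in its interior, given by generators and by
    inequalities, together with its incidence pattern. *)
Definition polar_pair d (V : 'M[R]_(d, n)) (A : 'M[R]_(d, m)) : Prop :=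
  conv V = polar_poly A /\
  forall i j, (dotp (col j A) (col i V) == 1) = inc i j.

(** The index sets of faces: the sets closed for the Galois connection of the
    incidence relation, and the empty set, which is the index set of the empty
    face. *)
Definition inc_face (I : {set 'I_n}) : Prop :=
  I = finset.set0 \/
  forall i, (forall j, (forall k, k \in I -> inc k j) -> inc i j) -> i \in I.

Section OnePair.
Variables (d : nat) (V : 'M[R]_(d, n)) (A : 'M[R]_(d, m)).
Hypothesis VA : polar_pair V A.

Lemma polar_pair_le i j : dotp (col j A) (col i V) <= 1.
Proof.
case: VA => cA _; have := conv_vertex V i; rewrite cA => /(_ j).
by rewrite -dotp_mulmx.
Qed.

Lemma polar_pair_eq i j : dotp (col j A) (col i V) = 1 <-> inc i j.
Proof. by case: VA => _ <-; split=> /eqP. Qed.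

Lemma facet_conv_on j :
  conv V `&` [set x | dotp (col j A) x = 1] = conv_on V [set i | inc i j]%SET.
Proof.
rewrite face_conv_on; last by move=> i; apply: polar_pair_le.
by congr conv_on; apply/setP => i; rewrite !inE; case: VA => _ ->.
Qed.

(** Let p be the barycenter of the vertices of a face and v a vertex on all facets
    that contain the face.  The other inequalities are strict at p, so moving from
    p slightly away from v stays in the polytope; as the supporting linear form
    is maximal at p, it must be maximal at v too. *)
Lemma face_inc_face G : face (conv V) G -> inc_face (verts V G).
Proof.
move=> [c [b [cb GE]]].
have [->|/set0Pn[k0 k0G]] := eqVneq (verts V G) finset.set0; [by left|right].
move=> i iG; apply/in_verts; rewrite GE; split; first exact: conv_vertex.
have inG k : k \in verts V G -> dotp c (col k V) = b.
  by move=> /in_verts; rewrite GE => -[].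
pose N : R := #|verts V G|%:R.
have N0 : 0 < N by rewrite ltr0n; apply/card_gt0P; exists k0.
pose p := N^-1 *: \sum_(k in verts V G) col k V.
have dotp_p a : dotp a p = N^-1 * \sum_(k in verts V G) dotp a (col k V).
  by rewrite /p dotpZr dotpC dotp_suml; congr (_ * _); apply: eq_bigr => k _; rewrite dotpC.
have cp : dotp c p = b.
  rewrite dotp_p (eq_bigr (fun=> b)) => [|k /inG//].
  by rewrite sumr_const -mulr_natr mulrA mulrC mulrA mulfV ?mul1r ?gt_eqF.
have ap1 j : (forall k, k \in verts V G -> inc k j) -> dotp (col j A) p = 1.
  move=> allj; rewrite dotp_p (eq_bigr (fun=> 1)) => [|k /allj/polar_pair_eq//].
  by rewrite sumr_const mulVf ?gt_eqF.
have aplt j : (exists2 k, k \in verts V G & ~~ inc k j) -> dotp (col j A) p < 1.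
  move=> [k kG kj]; rewrite dotp_p mulrC ltr_pdivrMr // mul1r /N -sumr_const.
  rewrite (bigD1 k) //= [ltRHS](bigD1 k) //= ltr_leD //.
    rewrite lt_neqAle polar_pair_le andbT; case: VA => _ ->; exact: kj.
  by apply: ler_sum => l _; apply: polar_pair_le.
clearbody p; pose v := col i V.
have [e e0 eP] : exists2 e : R, 0 < e &
    forall j, dotp (col j A) (p + e *: (p - v)) <= 1.
  (* Only the constraints that are strict at p limit the step; gap j is a step that
     constraint j allows. *)
  pose gap j := (1 - dotp (col j A) p) / (1 + `|dotp (col j A) (p - v)|).
  pose good j := dotp (col j A) p < 1.
  exists (\big[Num.min/1]_(j | good j) gap j).
    apply/bigmin_gtP; split=> // j gj; apply: divr_gt0; first by rewrite subr_gt0.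
    by rewrite ltr_wpDr.
  set e := \big[_/_]_(_ | _) _.
  have e_ge0 : 0 <= e.
    apply/bigmin_geP; split=> // j gj; apply: divr_ge0; first by rewrite subr_ge0 ltW.
    by rewrite addr_ge0.
  move=> j; rewrite dotpDr dotpZr.
  have [/existsP[k /andP[kG kj]]|] := boolP [exists k, (k \in verts V G) && ~~ inc k j].
    have gj : good j by apply: aplt; exists k.
    have eg : e <= gap j by apply: bigmin_le_cond.
    have pos : 0 < 1 + `|dotp (col j A) (p - v)| by rewrite ltr_wpDr.
    have h1 : e * (1 + `|dotp (col j A) (p - v)|) <= 1 - dotp (col j A) p.
      by rewrite -(ler_pdivlMr _ _ pos).
    rewrite -lerBrDl (le_trans _ h1) // ler_wpM2l // (le_trans (ler_norm _)) //.
    by rewrite lerDr.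
  rewrite negb_exists => /forallP allj.
  have allj' k : k \in verts V G -> inc k j.
    by move=> kG; have := allj k; rewrite kG /= negbK.
  have vj : dotp (col j A) v = 1 by apply/polar_pair_eq/iG.
  by rewrite dotpDr dotpNr vj ap1 // subrr mulr0 addr0.
have : conv V (p + e *: (p - v)).
  by case: VA => -> _ j; rewrite -dotp_mulmx.
move=> /cb; rewrite dotpDr dotpZr dotpDr dotpNr cp gerDl pmulr_rle0 // subr_le0 => bv.
by apply/eqP; rewrite eq_le bv andbT; apply: cb; apply: conv_vertex.
Qed.

(** The sum of the inequalities tight on I supports exactly the closed set I. *)
Lemma inc_face_face I :
  inc_face I -> face (conv V) (conv_on V I) /\ verts V (conv_on V I) = I.
Proof.
case=> [->|Icl].
  rewrite conv_on_set0; split; last first.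
    by apply/setP => i; rewrite !inE; apply/asboolP.
  exists 0, 1; rewrite /dotp trmx0; split=> [x _|]; first by rewrite mul0mx mxE ler01.
  apply/esym/seteqP; split=> // x [_ /=]; rewrite mul0mx mxE => /eqP.
  by rewrite eq_sym oner_eq0.
pose J := [set j | [forall k in I, inc k j]]%SET.
have JP j : reflect (forall k, k \in I -> inc k j) (j \in J).
  by rewrite inE; apply: forall_inP.
pose c := \sum_(j in J) col j A.
pose b : R := #|J|%:R.
have cE x : dotp c x = \sum_(j in J) dotp (col j A) x by apply: dotp_suml.
have c_le i : dotp c (col i V) <= b.
  by rewrite cE /b -sumr_const; apply: ler_sum => j _; apply: polar_pair_le.
have cI i : (dotp c (col i V) == b) = (i \in I).
  apply/eqP/idP => [cib|iI]; last first.
    by rewrite cE /b -sumr_const; apply: eq_bigr => j /JP/(_ _ iI)/polar_pair_eq.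
  apply: Icl => j /JP jJ; apply/polar_pair_eq/eqP; rewrite eq_le polar_pair_le /=.
  rewrite leNgt; apply/negP => lt1.
  have : dotp c (col i V) < b.
    rewrite cE /b -sumr_const (bigD1 j) //= [ltRHS](bigD1 j) //= ltr_leD //.
    by apply: ler_sum => k _; apply: polar_pair_le.
  by rewrite cib ltxx.
have IE : conv_on V I = conv V `&` [set x | dotp c x = b].
  by rewrite face_conv_on //; congr conv_on; apply/setP => i; rewrite inE cI.
split; first by exists c, b; split=> // x; apply: dotp_conv_le.
apply/setP => i; apply/idP/idP => [/in_verts|iI].
  by rewrite IE => -[_ /= /eqP]; rewrite cI.
by apply/in_verts/conv_on_vertex.
Qed.

End OnePair.

(** By [face_inc_face] and [inc_face_face] the faces of both polytopes correspond to
    the same index sets. *)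
Lemma polar_pair_comb_equiv d d' (V : 'M[R]_(d, n)) (A : 'M[R]_(d, m))
    (V' : 'M[R]_(d', n)) (A' : 'M[R]_(d', m)) :
  polar_pair V A -> polar_pair V' A' ->
  (forall i, face (conv V) [set col i V]) -> injective (fun i => col i V) ->
  comb_equiv (labeled_conv V A) (labeled_conv V' A').
Proof.
move=> VA VA' vf vinj; exists (fun G => conv_on V' (verts V G)); split => /=.
- split.
  + by move=> G /(face_inc_face VA)/(inc_face_face VA')[].
  + move=> G H; rewrite !inE => fG fH GH.
    have [_ vG] := inc_face_face VA' (face_inc_face VA fG).
    have [_ vH] := inc_face_face VA' (face_inc_face VA fH).
    by rewrite (faceE fG) (faceE fH) -vG GH vH.
  + move=> G' fG'; have iG' := face_inc_face VA' fG'.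
    have [fG vG] := inc_face_face VA iG'.
    by exists (conv_on V (verts V' G')) => //; rewrite vG -faceE.
- move=> G H fG fH; split=> [GH|sub].
    apply: conv_on_sub; apply/fintype.subsetP => i /in_verts Gi.
    by apply/in_verts/GH.
  have [_ vG] := inc_face_face VA' (face_inc_face VA fG).
  have [_ vH] := inc_face_face VA' (face_inc_face VA fH).
  rewrite (faceE fG) (faceE fH); apply: conv_on_sub; rewrite -vG -vH.
  by apply/fintype.subsetP => i /in_verts/sub/in_verts.
- move=> i; rewrite -[RHS]conv_on_set1; congr conv_on; apply/setP => k.
  rewrite [RHS]inE; apply/idP/eqP => [/in_verts/vinj//|->].
  by apply/in_verts.
- move=> j; rewrite !(facet_conv_on VA, facet_conv_on VA'); congr conv_on.
  have jf : inc_face [set i | inc i j]%SET.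
    by right=> i; rewrite inE; apply=> k; rewrite inE.
  by have [_] := inc_face_face VA jf.
Qed.

End IncidencePatterns.

(** * Polars close to a polytope *)

Section PolarInConv.
Context {R : realType}.

(** Given y with tight constraints J and a vertex v tight on J, the ray from v
    through y stays tight on J and exits at a point z with one more tight
    constraint; y is a convex combination of v and z.  The last hypothesis
    provides v. *)
Lemma polar_sub_conv d n m (V : 'M[R]_(d, n)) (A : 'M[R]_(d, m))
    (inc : 'I_n -> 'I_m -> bool) :
  (forall i j, inc i j -> dotp (col j A) (col i V) = 1) ->
  (forall i j, dotp (col j A) (col i V) <= 1) ->
  (forall y, (forall j, dotp (col j A) y <= 0) -> y = 0) ->
  (forall J : {set 'I_m}, (forall i, exists2 j, j \in J & ~~ inc i j) ->
     forall y, polar_poly A y -> exists2 j, j \in J & dotp (col j A) y <> 1) ->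
  polar_poly A `<=` conv V.
Proof.
move=> inc1 le1 rec0 noJ.
suff H k (J : {set 'I_m}) y : (#|~: J| < k)%N -> polar_poly A y ->
    (forall j, j \in J -> dotp (col j A) y = 1) -> conv V y.
  move=> y Ay; apply: (H _ finset.set0) => // j; by rewrite inE.
elim: k J y => // k IH J y Jk Ay yJ.
have [i iJ] : exists i, forall j, j \in J -> inc i j.
  apply: contrapT => noi; have [|j jJ] := noJ J _ y Ay; last by rewrite yJ.
  move=> i; apply: contrapT => noj; apply: noi; exists i => j jJ.
  by apply: contrapT => /negP ij; apply: noj; exists j.
have [->|yi] := eqVneq y (col i V); first exact: conv_vertex.
pose v := col i V; have {yi} yv0 : y - v != 0 by rewrite subr_eq0.
have [j0 j0P] : exists j, 0 < dotp (col j A) (y - v).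
  apply: contrapT => noj; move/eqP: yv0; apply; apply: rec0 => j.
  by rewrite leNgt; apply/negP => jP; apply: noj; exists j.
have j0J j : 0 < dotp (col j A) (y - v) -> j \notin J.
  apply: contraL => jJ; rewrite -leNgt dotpDr dotpNr yJ // inc1 ?subrr //.
  exact: iJ.
(* The ray parameter at which constraint j becomes tight; j minimizes it. *)
pose ratio j := (1 - dotp (col j A) v) / dotp (col j A) (y - v).
have [j jP jmin] : exists2 j, 0 < dotp (col j A) (y - v) &
    forall j', 0 < dotp (col j' A) (y - v) -> ratio j <= ratio j'.
  by case: (@arg_minP _ _ _ j0 (fun j => 0 < dotp (col j A) (y - v)) ratio j0P)
    => j jP jmin; exists j.
set t := ratio j in jmin.
have ay1 j' : dotp (col j' A) y <= 1 by rewrite dotp_mulmx.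
have t1 : 1 <= t.
  by rewrite /t /ratio ler_pdivlMr // mul1r dotpDr dotpNr lerB.
have t0 : 0 < t by apply: lt_le_trans t1.
pose z := v + t *: (y - v).
have aE j' : dotp (col j' A) z = dotp (col j' A) v + t * dotp (col j' A) (y - v).
  by rewrite /z dotpDr dotpZr.
have cz : conv V z.
  apply: (IH (j |: J)).
  - rewrite ltnS in Jk; apply: leq_trans Jk; apply: proper_card; apply/properP; split.
      by rewrite finset.setCS finset.subsetUr.
    by exists j; rewrite !inE ?eqxx ?j0J.
  - move=> j'; rewrite -dotp_mulmx aE.
    have [le0|gt0] := leP (dotp (col j' A) (y - v)) 0.
      rewrite -[leRHS]addr0 lerD ?le1 //.
      by rewrite mulr_ge0_le0 // ltW.
    by rewrite -lerBrDl -ler_pdivlMr //; apply: jmin.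
  - move=> j'; rewrite in_setU1 => /orP[/eqP ->|j'J].
      by rewrite aE /t /ratio divfK ?gt_eqF // addrC subrK.
    rewrite aE dotpDr dotpNr yJ // inc1; last exact: iJ.
    by rewrite subrr mulr0 addr0.
have -> : y = t^-1 *: z + (1 - t^-1) *: v.
  rewrite /z scalerDr scalerA mulVf ?gt_eqF // scale1r scalerBl scale1r.
  by rewrite [RHS]addrC addrA subrK [RHS]addrC subrK.
apply: conv_convex => //; first exact: conv_vertex.
  by rewrite invr_ge0 ltW.
by rewrite invf_le1.
Qed.

Lemma conv_bounded d n (V : 'M[R]_(d, n)) :
  exists B : R, forall x, conv V x -> `|x| <= B.
Proof.
exists (\sum_i `|col i V|) => x [l [l0 l1 ->]].
rewrite mulmx_sum_col (le_trans (ler_norm_sum _ _ _)) // ler_sum // => i _.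
rewrite normrZ ger0_norm // ler_piMl // -l1 (bigD1 i) //= lerDl.
by apply: sumr_ge0 => k _.
Qed.

(** A recession direction would give an unbounded ray in the bounded set conv V. *)
Lemma recession_trivial d n m (V : 'M[R]_(d, n)) (A : 'M[R]_(d, m)) :
  conv V = polar_poly A ->
  forall y, (forall j, dotp (col j A) y <= 0) -> y = 0.
Proof.
move=> VA y yP; have [B BP] := conv_bounded V; apply/eqP; apply/negPn/negP => y0.
have ny : 0 < `|y| by rewrite normr_gt0.
(* Far enough along the ray to exceed the bound B. *)
pose t := (`|B| + 1) / `|y|.
have t0 : 0 < t by rewrite divr_gt0 // ltr_wpDl.
have : conv V (t *: y).
  rewrite VA => j; rewrite -dotp_mulmx dotpZr (@le_trans _ _ 0) //.
  by rewrite mulr_ge0_le0 // ltW.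
move=> /BP; rewrite normrZ gtr0_norm // /t divfK ?gt_eqF // => h.
have := le_trans h (ler_norm B); rewrite leNgt ltrDl ltr01 //.
Qed.

(** On the unit sphere some constraint is strictly violated, which is an open
    condition on the vector and on B; the sphere is compact. *)
Lemma cone_trivial_open e m (B0 : 'M[R]_(e, m)) (J : {set 'I_m}) :
  (forall w, (forall j, dotp (col j B0) w <= 0) ->
     (forall j, j \in J -> dotp (col j B0) w = 0) -> w = 0) ->
  \forall B \near B0, forall w, (forall j, dotp (col j B) w <= 0) ->
     (forall j, j \in J -> dotp (col j B) w = 0) -> w = 0.
Proof.
move=> B0P; pose K := [set u : 'rV[R]_e | `|u| = 1].
have cK : compact K.
  apply: bounded_closed_compact.
    by exists 1; split=> // M M1 u /= ->; rewrite ltW.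
  have -> : K = (fun u : 'rV[R]_e => `|u|) @^-1` [set 1] by [].
  apply: closed_comp; last exact: closed_eq.
  by move=> u _; apply: norm_continuous.
pose P (B : 'M[R]_(e, m)) (u : 'rV[R]_e) :=
  exists j, 0 < dotp (col j B) u^T \/ j \in J /\ dotp (col j B) u^T < 0.
have cover u : K u -> \forall u' \near u & B \near B0, P B u'.
  move=> Ku; pose G j (p : 'rV[R]_e * 'M[R]_(e, m)) := dotp (col j p.2) p.1^T.
  have Gc j : {for (u, B0), continuous (G j)}.
    have -> : G j = \sum_k (fun p : 'rV[R]_e * 'M[R]_(e, m) => p.2 k j * p.1 0 k).
      apply/funext => p; rewrite fct_sumE /G dotpE; apply: eq_bigr => k _.
      by rewrite !mxE.
    apply: (big_ind (fun g : 'rV[R]_e * 'M[R]_(e, m) -> R =>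
      {for (u, B0), continuous g})) => [|g h|k _].
    - exact: (@cst_continuous _ _ 0).
    - exact: continuousD.
    - apply: (@continuousM _ _ (fun p : 'rV[R]_e * 'M[R]_(e, m) => p.2 k j)
         (fun p : 'rV[R]_e * 'M[R]_(e, m) => p.1 0 k)).
        apply: (@continuous_comp _ _ _ snd (fun M : 'M[R]_(e, m) => M k j)).
          exact: cvg_snd.
        exact: coord_continuous.
      apply: (@continuous_comp _ _ _ fst (fun M : 'rV[R]_e => M 0 k)).
        exact: cvg_fst.
      exact: coord_continuous.
  have [j jP] : P B0 u.
    apply: contrapT => nP.
    have u0 : u^T = 0.
      have le0 j : dotp (col j B0) u^T <= 0.
        by rewrite leNgt; apply/negP => h; apply: nP; exists j; left.
      apply: B0P => // j jJ; apply/eqP; rewrite eq_le le0 leNgt.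
      by apply/negP => h; apply: nP; exists j; right.
    move: Ku; rewrite /K /= -[u]trmxK u0 trmx0 normr0 => /eqP.
    by rewrite eq_sym oner_eq0.
  have near_nz (S : set R) : open S -> S (G j (u, B0)) ->
      \forall p \near (u, B0), S (G j p).
    by move=> oS SG; apply: (Gc j); apply: open_nbhs_nbhs.
  case: jP => [gt0|[jJ lt0]].
    have := near_nz _ (@open_gt R 0) gt0.
    by apply: filterS => p h; exists j; left.
  have := near_nz _ (@open_lt R 0) lt0.
  by apply: filterS => p h; exists j; right.
have near := (iffLR (compact_near_coveringP K) cK) _ _ P _ cover.
near=> B; move=> w wle weq; apply/eqP/negPn/negP => w0.
have nw : 0 < `|w| by rewrite normr_gt0.
have nwT : `|w^T| != 0 by rewrite normr_eq0 trmx_eq0.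
have KP : K `<=` P B by near: B; exact: near.
have [|j jP] := KP (`|w^T|^-1 *: w^T).
  by rewrite /K /= normrZ normfV normr_id mulVf.
move: jP; rewrite linearZ /= trmxK dotpZr => -[|[jJ]].
  have inv0 : 0 < `|w^T|^-1 by rewrite invr_gt0 lt0r nwT normr_ge0.
  by rewrite (pmulr_rgt0 _ inv0) ltNge wle.
by rewrite weq // mulr0 ltxx.
Unshelve. all: by end_near. Qed.

End PolarInConv.

(** * Affine dimension *)

Section AffineDimension.
Context {R : realType}.

Lemma aff_indep_leq e r (X : 'M[R]_(e, r)) : aff_indep X -> (r <= e.+1)%N.
Proof.
move=> rX; have := rank_leq_row (col_mx X (const_mx 1 : 'rV[R]_r)).
by rewrite rX addn1.
Qed.

Lemma affdim_ge e r (S : set 'cV[R]_e) (X : 'M[R]_(e, r)) :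
  (forall j, S (col j X)) -> aff_indep X -> r%:Z - 1 <= affdim S.
Proof.
move=> SX iX; rewrite lerD2r lez_nat.
have re : (r < e.+2)%N by rewrite ltnS; apply: aff_indep_leq iX.
apply: (@leq_bigmax_cond _ _ (fun i : 'I_e.+2 => i : nat) (Ordinal re)).
by apply/asboolP; exists X.
Qed.

Lemma affdim_witness e r (S : set 'cV[R]_e) :
  affdim S = r%:Z - 1 ->
  exists2 X : 'M[R]_(e, r), forall j, S (col j X) & aff_indep X.
Proof.
move=> /eqP; rewrite (inj_eq (addIr _)) eqz_nat => /eqP rE.
pose P (i : 'I_e.+2) := `[< exists2 X : 'M[R]_(e, i), forall j, S (col j X) & aff_indep X >].
have P0 : P ord0.
  apply/asboolP; exists (0 : 'M[R]_(e, 0)); first by case.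
  by apply/eqP; rewrite -leqn0 rank_leq_col.
have cP : (0 < #|P|)%N by apply/card_gt0P; exists ord0.
have [i Pi iE] := eq_bigmax_cond (fun i : 'I_e.+2 => i : nat) cP.
by move: Pi => /asboolP; rewrite -iE -/(P _) rE.
Qed.

Lemma affdim_le e r (S : set 'cV[R]_e) :
  (forall k (X : 'M[R]_(e, k)), (forall j, S (col j X)) -> aff_indep X -> (k <= r)%N) ->
  affdim S <= r%:Z - 1.
Proof.
move=> Sr; rewrite lerD2r lez_nat; apply/bigmax_leqP => i /asboolP[X SX iX].
exact: Sr SX iX.
Qed.

(** The equation of the hyperplane is a nonzero vector in the left kernel of the
    homogenized points. *)
Lemma affdim_le_hyperplane e (S : set 'cV[R]_e) c b : c != 0 ->
  (forall x, S x -> dotp c x = b) -> affdim S <= e%:Z - 1.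
Proof.
move=> c0 Sb; apply: affdim_le => k X SX iX.
have := iX; rewrite /aff_indep => iX'.
have h0 : row_mx c^T (const_mx (- b)) *m col_mx X (const_mx 1 : 'rV[R]_k) = 0.
  have cX : c^T *m X = const_mx b.
    apply/rowP => j; rewrite [RHS]mxE -(Sb _ (SX j)) /dotp !mxE.
    by apply: eq_bigr => i _; rewrite !mxE.
  rewrite mul_row_col cX; apply/rowP => j; rewrite !mxE big_ord1 !mxE mulr1.
  exact: subrr.
have := mulmx0_rank_max h0; rewrite iX'.
suff : (0 < \rank (row_mx c^T (const_mx (- b) : 'M[R]_1)))%N.
  case: (\rank _) => // r _; rewrite addn1 addSn ltnS; apply: leq_trans.
  exact: leq_addl.
rewrite lt0n mxrank_eq0; apply/eqP => /(congr1 lsubmx).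
by rewrite row_mxKl linear0 => /eqP; rewrite trmx_eq0 (negbTE c0).
Qed.

Lemma affdim_le_dim e (S : set 'cV[R]_e) : affdim S <= e%:Z.
Proof.
have -> : e%:Z = e.+1%:Z - 1 by rewrite -addn1 PoszD addrK.
by apply: affdim_le => k X _; apply: aff_indep_leq.
Qed.

(** The e affinely independent points satisfy a homogenized linear relation with
    constant term 1, so they are already linearly independent and determine it. *)
Lemma hyperplane_unique e (S : set 'cV[R]_e) (a b : 'cV[R]_e) :
  affdim S = e%:Z - 1 -> (forall x, S x -> dotp a x = 1) ->
  (forall x, S x -> dotp b x = 1) -> a = b.
Proof.
move=> /affdim_witness[X SX iX] Sa Sb.
have rows c : (forall x, S x -> dotp c x = 1) -> c^T *m X = const_mx 1.
  move=> Sc; apply/rowP => j; rewrite [RHS]mxE -(Sc _ (SX j)) /dotp !mxE.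
  by apply: eq_bigr => i _; rewrite !mxE.
have uX : X \in unitmx.
  rewrite -row_full_unit /row_full eqn_leq rank_leq_row /= -{1}iX -(rows _ Sa).
  by rewrite -{1}[X]mul1mx -mul_col_mx mxrankM_maxr.
apply: trmx_inj; apply: (can_inj (mulmxK uX)).
by rewrite (rows _ Sa) (rows _ Sb).
Qed.

(** A left inverse of the homogenized points stays a left inverse up to an
    invertible matrix. *)
Lemma aff_indep_near d n r (V0 : 'M[R]_(d, n)) (L : 'M[R]_(n, r)) :
  aff_indep (V0 *m L) -> \forall V \near V0, aff_indep (V *m L).
Proof.
move=> iX; pose M (V : 'M[R]_(d, n)) := col_mx (V *m L) (const_mx 1 : 'rV[R]_r).
pose B := pinvmx (M V0).
have BM : B *m M V0 = 1%:M by rewrite mulVpmx // /row_full iX.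
have Ms : smooth_on [set: 'M[R]_(d, n)] (fun V => \det (B *m M V)).
  apply: smooth_on_det; first exact: openT.
  have VLs a j : smooth_on [set: 'M[R]_(d, n)] (fun V => (V *m L) a j).
    under [X in smooth_on _ X]funext do rewrite mxE.
    apply: smooth_on_sum => [|l _]; first exact: openT.
    by apply: smooth_onM; [exact: openT|exact: smooth_on_coord|exact: smooth_on_cst].
  move=> i j; under [X in smooth_on _ X]funext do rewrite mxE.
  apply: smooth_on_sum => [|k _]; first exact: openT.
  apply: smooth_onM; [exact: openT|exact: smooth_on_cst|].
  under [X in smooth_on _ X]funext do rewrite mxE.
  by case: (fintype.split k) => a; [exact: VLs|exact: smooth_on_cst].
have detc : {for V0, continuous (fun V => \det (B *m M V))}.
  exact: smooth_on_continuous Ms I.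
have : \forall V \near V0, \det (B *m M V) != 0.
  apply: (detc [set t | t != 0]); apply: open_nbhs_nbhs; split=> /=.
    by have := @open_neq R 0.
  by rewrite BM det1 oner_neq0.
apply: filterS => V /= dn; apply/eqP; rewrite eqn_leq rank_leq_col /=.
have uBM : B *m M V \in unitmx by rewrite unitmxE unitfE.
by rewrite -{1}(mxrank_unit uBM) mxrankM_maxr.
Qed.

(** Affinely independent points of the hull are moved along with the columns of V by
    keeping their barycentric coordinates. *)
Lemma affdim_conv_on_near d n (V0 : 'M[R]_(d, n)) (I : {set 'I_n}) :
  \forall V \near V0, affdim (conv_on V0 I) <= affdim (conv_on V I).
Proof.
have [r rE] : exists r : nat, affdim (conv_on V0 I) = r%:Z - 1 by eexists.
have [X SX iX] := affdim_witness rE.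
have lex j : exists lj, weights I lj /\ col j X = V0 *m lj.
  by have [lj ? ?] := SX j; exists lj.
have [l lP] := choice lex.
pose L : 'M[R]_(n, r) := \matrix_(i, j) l j i 0.
have colL j : col j L = l j by apply/colP => i; rewrite !mxE.
have XL : X = V0 *m L.
  apply/matrixP => i j; have [_ /colP/(_ i)] := lP j.
  by rewrite -colL [col j L]colE mulmxA -colE !mxE.
rewrite XL in iX; apply: filterS (aff_indep_near iX) => V iV.
rewrite rE; apply: affdim_ge iV => j; exists (l j); first by case: (lP j).
by rewrite -colL !colE mulmxA.
Qed.

End AffineDimension.

(** * Stability of the combinatorial type *)

Section Stability.
Context {R : realType}.

(** Vertices and facets of the perturbed polytope are found among the faces with the
    same index sets.  A facet index set spans a hyperplane, since its affine
    dimension has not dropped.  Conversely a face of dimension d - 1 lies in some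
    facet, in only one because its hyperplane is unique, and therefore equals
    it. *)
Lemma labeled_polytope_transfer d n m inc (V0 V : 'M[R]_(d, n)) (A0 A : 'M[R]_(d, m)) :
  (0 < d)%N -> polar_pair inc V0 A0 -> polar_pair inc V A ->
  labeled_polytope d (labeled_conv V0 A0) ->
  (forall I, affdim (conv_on V0 I) <= affdim (conv_on V I)) ->
  labeled_polytope d (labeled_conv V A).
Proof.
move=> d0 VA0 VA [_ /= dimV0 [vinj0 vface0] [finj0 fface0]] dimle.
have fullV : affdim (conv V) = d%:Z.
  by apply/eqP; rewrite eq_le affdim_le_dim -dimV0 !conv_onT dimle.
have inc1 i : inc_face inc [set i]%SET.
  have <- : verts V0 [set col i V0] = [set i]%SET.
    apply/setP => k; rewrite [RHS]inE; apply/idP/eqP => [/in_verts/vinj0//|->].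
    by apply/in_verts.
  by apply: (face_inc_face VA0); apply/vface0; exists i.
have incF j : inc_face inc [set i | inc i j]%SET.
  by right=> i; rewrite inE; apply=> k; rewrite inE.
have facetE j : conv V `&` [set x | dotp (col j A) x = 1] = conv_on V [set i | inc i j]%SET.
  exact: facet_conv_on.
have facetE0 j : conv V0 `&` [set x | dotp (col j A0) x = 1] = conv_on V0 [set i | inc i j]%SET.
  exact: facet_conv_on.
have facet_inj : injective (fun j => conv V `&` [set x | dotp (col j A) x = 1]).
  move=> j k; rewrite !facetE => jk; apply: finj0; rewrite !facetE0.
  have [_ <-] := inc_face_face VA (incF j); have [_ <-] := inc_face_face VA (incF k).
  by rewrite jk.
split=> /=.
- by exists n, V.
- exact: fullV.
- split=> [i k ik|x].
    have [_ vi] := inc_face_face VA (inc1 i).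
    apply/eqP; rewrite eq_sym -finset.in_set1 -vi; apply/in_verts.
    by rewrite conv_on_set1 /= ik.
  split=> [[i <-]|fx].
    by rewrite -conv_on_set1; apply: (inc_face_face VA (inc1 i)).1.
  have := faceE fx; set I := verts _ _ => IE.
  have : conv_on V I x by rewrite -IE.
  move=> [l /weights_ex[i iI _] _]; exists i.
  by have : conv_on V I (col i V) by [apply: conv_on_vertex]; rewrite -IE.
- split=> // G; split=> [[j <-]|[fG dG]].
    split; first by rewrite facetE; apply: (inc_face_face VA (incF j)).1.
    apply/eqP; rewrite eq_le; apply/andP; split.
      have [f0 dim0] := (fface0 _).1 (ex_intro _ j erefl).
      have [a0|a0] := eqVneq (col j A) 0.
        rewrite (_ : _ `&` _ = set0).
          apply: (@affdim_le _ _ d) => k X SX _.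
          by case: k X SX => [|k] X // /(_ ord0) [].
        by apply/seteqP; split=> // x [_] /=; rewrite a0 /dotp trmx0 mul0mx mxE => /esym/eqP; rewrite oner_eq0.
      by apply: (affdim_le_hyperplane (b := 1) a0) => x [].
    have [f0 <-] := (fface0 _).1 (ex_intro _ j erefl).
    by rewrite facetE facetE0.
  have GI := faceE fG; set I := verts V G in GI.
  have dG' : affdim G = d%:Z - 1 by [].
  have [X SX _] := affdim_witness dG'.
  have [i0 i0I] : exists i, i \in I.
    have := SX (Ordinal d0); rewrite GI => -[l /weights_ex[i iI _] _].
    by exists i.
  have Icl : forall i, (forall j, (forall k, k \in I -> inc k j) -> inc i j) -> i \in I.
    case: (face_inc_face VA fG) => // I0.
    by move: i0I; rewrite /I I0 inE.
  have [j jI] : exists j, forall k, k \in I -> inc k j.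
    apply: contrapT => noj.
    have IT : I = [set: 'I_n]%SET.
      apply/setP => i; rewrite [RHS]inE; apply: Icl => j jI.
      by case: noj; exists j.
    move: dG'; rewrite GI IT -conv_onT fullV => /eqP.
    by rewrite -subr_eq0 opprB addrC subrK.
  have hyp k : (forall i, i \in I -> inc i k) -> forall x, G x -> dotp (col k A) x = 1.
    move=> kI x; rewrite GI; apply: dotp_conv_on_eq => i /kI.
    by move/(polar_pair_eq VA).
  exists j; rewrite facetE GI; congr conv_on; apply/setP => i; rewrite inE.
  apply/idP/idP => [ij|/jI//]; apply: Icl => k kI.
  suff <- : j = k by [].
  apply: facet_inj; congr (_ `&` _).
  by rewrite (hyperplane_unique dG' (hyp _ jI) (hyp _ kI)).
Qed.

(** A nonzero solution (y, s) with s > 0 would give the point y / s of the polytope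
    at which all constraints of J are tight, so the face they cut out would
    be nonempty and have a vertex, which J excludes.  A solution with s <= 0 is a recession direction. *)
Lemma homogenized_cone_trivial d n m inc (V0 : 'M[R]_(d, n)) (A0 : 'M[R]_(d, m))
    (J : {set 'I_m}) : polar_pair inc V0 A0 ->
  (forall i, exists2 j, j \in J & ~~ inc i j) ->
  forall w, (forall j, dotp (col j (col_mx A0 (const_mx (-1)))) w <= 0) ->
    (forall j, j \in J -> dotp (col j (col_mx A0 (const_mx (-1)))) w = 0) ->
    w = 0 :> 'cV[R]_(d + 1).
Proof.
move=> VA noJ w; rewrite -[w]vsubmxK; move: (usubmx w) (dsubmx w) => y s1 {w}.
pose s := s1 0 0.
have dE j : dotp (col j (col_mx A0 (const_mx (-1)))) (col_mx y s1) =
    dotp (col j A0) y - s.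
  rewrite !dotpE big_split_ord /= big_ord1; congr (_ + _).
    by apply: eq_bigr => k _; rewrite mxE !col_mxEu [in RHS]mxE.
  by rewrite mxE !col_mxEd mxE mulN1r.
case: (VA) => cA _.
have zero_polar : polar_poly A0 (0 : 'cV[R]_d).
  by move=> j; rewrite mulmx0 mxE ler01.
have [i0 _] : exists i : 'I_n, i \in [set: 'I_n]%SET.
  by move: zero_polar; rewrite -cA conv_onT => -[l /weights_ex[i iT _] _]; exists i.
have [j0 j0J _] := noJ i0.
move=> wle weq.
have yle j : dotp (col j A0) y <= s by rewrite -subr_le0 -dE.
have yeq j : j \in J -> dotp (col j A0) y = s.
  by move=> jJ; apply/eqP; rewrite -subr_eq0 -dE weq.
have [s0|s0] := ltP 0 s.
  have Ax : conv V0 (s^-1 *: y).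
    rewrite cA => j; rewrite -dotp_mulmx dotpZr mulrC.
    by rewrite (ler_pdivrMr _ _ s0) mul1r.
  pose c := \sum_(j in J) col j A0.
  have cE x : dotp c x = \sum_(j in J) dotp (col j A0) x by apply: dotp_suml.
  have cle i : dotp c (col i V0) <= #|J|%:R.
    by rewrite cE -sumr_const; apply: ler_sum => j _; apply: (polar_pair_le VA).
  have : (conv V0 `&` [set x | dotp c x = #|J|%:R]) (s^-1 *: y).
    split=> //=; rewrite cE -sumr_const; apply: eq_bigr => j jJ.
    by rewrite dotpZr yeq // mulVf // gt_eqF.
  rewrite face_conv_on // => -[l /weights_ex[i + _] _]; rewrite inE => /eqP ci.
  have [j jJ /negP[]] := noJ i; apply/(polar_pair_eq VA)/eqP.
  rewrite eq_le (polar_pair_le VA) /= leNgt; apply/negP => lt1.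
  move: ci; apply/eqP; rewrite lt_eqF // cE -sumr_const.
  rewrite (bigD1 j) //= [ltRHS](bigD1 j) //= ltr_leD //.
  by apply: ler_sum => k _; apply: (polar_pair_le VA).
have y0 : y = 0.
  by apply: (recession_trivial cA) => j; apply: le_trans (yle j) s0.
have s1E : s = 0 by rewrite -(yeq _ j0J) y0 dotp0r.
rewrite y0; apply/colP => k; rewrite mxE; case: splitP => a _; rewrite !mxE //.
by rewrite ord1 -/s s1E.
Qed.

(** The hypotheses of [polar_sub_conv] are open: finitely many strict inequalities
    between entries of V and A, and the triviality of finitely many cones. *)
Lemma polar_pair_near d n m (V0 : 'M[R]_(d, n)) (A0 : 'M[R]_(d, m)) inc :
  polar_pair inc V0 A0 ->
  \forall W \near row_mx V0 A0,
    (forall i j, inc i j -> dotp (col j (rsubmx W)) (col i (lsubmx W)) = 1) ->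
    polar_pair inc (lsubmx W) (rsubmx W).
Proof.
move=> VA; case: (VA) => cA _.
have lnear (Q : set 'M[R]_(d, n)) : (\forall V \near V0, Q V) ->
    \forall W \near row_mx V0 A0, Q (lsubmx W).
  move=> QV; have lc : continuous (@lsubmx R d n m) by apply: linear_mx_continuous.
  by apply: (lc (row_mx V0 A0)); rewrite row_mxKl.
have rnear (Q : set 'M[R]_(d, m)) : (\forall A \near A0, Q A) ->
    \forall W \near row_mx V0 A0, Q (rsubmx W).
  move=> QA; have rc : continuous (@rsubmx R d n m) by apply: linear_mx_continuous.
  by apply: (rc (row_mx V0 A0)); rewrite row_mxKr.
have lt_near i j : dotp (col j A0) (col i V0) < 1 ->
    \forall W \near row_mx V0 A0, dotp (col j (rsubmx W)) (col i (lsubmx W)) < 1.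
  move=> lt1.
  pose G (W : 'M[R]_(d, n + m)) := dotp (col j (rsubmx W)) (col i (lsubmx W)).
  have GE W : G W = \sum_k W k (rshift n j) * W k (lshift m i).
    by rewrite /G dotpE; apply: eq_bigr => k _; rewrite !mxE.
  have Gs : smooth_on [set: 'M[R]_(d, n + m)] G.
    rewrite (funext GE); apply: smooth_on_sum => [|k _]; first exact: openT.
    by apply: smooth_onM; [exact: openT|exact: smooth_on_coord..].
  have Gc : {for row_mx V0 A0, continuous G} by exact: smooth_on_continuous Gs I.
  apply: (Gc [set t | t < 1]); apply: open_nbhs_nbhs; split.
    exact: (@open_lt R 1).
  by rewrite /= /G row_mxKl row_mxKr.
have rec_near : \forall A \near A0,
    forall y : 'cV[R]_d, (forall j, dotp (col j A) y <= 0) -> y = 0.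
  have h0 : forall w : 'cV[R]_d, (forall j, dotp (col j A0) w <= 0) ->
     (forall j, j \in (finset.set0 : {set 'I_m}) -> dotp (col j A0) w = 0) -> w = 0.
    by move=> w wle _; apply: (recession_trivial cA).
  apply: filterS (cone_trivial_open h0) => A AP y yle.
  by apply: AP => // j; rewrite inE.
have empty_near (J : {set 'I_m}) : (forall i, exists2 j, j \in J & ~~ inc i j) ->
    \forall A \near A0, forall y, polar_poly A y ->
      exists2 j, j \in J & dotp (col j A) y <> 1.
  move=> noJ; have := cone_trivial_open (homogenized_cone_trivial VA noJ).
  pose hom (A : 'M[R]_(d, m)) := col_mx A (const_mx (-1) : 'rV[R]_m).
  have homc : {for A0, continuous hom}.
    apply/mx_continuousP => i j; rewrite -[i]splitK.
    case: (fintype.split i) => a /=.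
      rewrite (_ : (fun A => hom A _ j) = fun A => A a j); last first.
        by apply/funext => A; rewrite /hom col_mxEu.
      exact: coord_continuous.
    rewrite (_ : (fun A => hom A _ j) = cst (-1)); first exact: cst_continuous.
    by apply/funext => A; rewrite /hom col_mxEd mxE.
  move=> trivial_near.
  have hom_near : \forall A \near A0, forall w : 'cV[R]_(d + 1),
      (forall j, dotp (col j (hom A)) w <= 0) ->
      (forall j, j \in J -> dotp (col j (hom A)) w = 0) -> w = 0.
    exact: homc trivial_near.
  apply: filterS hom_near => A AP y Ay; apply: contrapT => noj.
  have dE j : dotp (col j (hom A)) (col_mx y (1 : 'M[R]_1)) = dotp (col j A) y - 1.
    rewrite !dotpE big_split_ord /= big_ord1; congr (_ + _).
      by apply: eq_bigr => k _; rewrite mxE !col_mxEu [in RHS]mxE.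
    by rewrite mxE !col_mxEd !mxE mulr1.
  have /(congr1 dsubmx) : col_mx y (1 : 'M[R]_1) = 0.
    apply: AP => [j|j jJ]; first by rewrite dE subr_le0 dotp_mulmx.
    rewrite dE; apply/eqP; rewrite subr_eq0; apply/eqP; apply: contrapT => jy.
    by apply: noj; exists j.
  by rewrite col_mxKd linear0 => /eqP; rewrite oner_eq0.
near=> W => inc1.
have lt1 i j : ~~ inc i j -> dotp (col j (rsubmx W)) (col i (lsubmx W)) < 1.
  move: i j; near: W; apply: filter_forall => i; apply: filter_forall => j.
  have [ij|/negP ij] := boolP (inc i j); first by apply: nearW.
  have : dotp (col j A0) (col i V0) < 1.
    by rewrite lt_neqAle (polar_pair_le VA) andbT; apply/eqP => /(polar_pair_eq VA).
  by move=> /lt_near; apply: filterS.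
have rec : forall y, (forall j, dotp (col j (rsubmx W)) y <= 0) -> y = 0.
  by near: W; exact: (rnear _ rec_near).
have noJ : forall J : {set 'I_m}, (forall i, exists2 j, j \in J & ~~ inc i j) ->
     forall y, polar_poly (rsubmx W) y ->
       exists2 j, j \in J & dotp (col j (rsubmx W)) y <> 1.
  near: W; apply: filter_forall => J.
  have [h|h] := pselect (forall i, exists2 j, j \in J & ~~ inc i j).
    by apply: filterS (rnear _ (empty_near _ h)) => W + _.
  by apply: nearW.
have le1 i j : dotp (col j (rsubmx W)) (col i (lsubmx W)) <= 1.
  by have [/inc1->//|/lt1/ltW] := boolP (inc i j).
split.
  apply/seteqP; split=> [x cx j|]; last exact: (polar_sub_conv inc1).
  by rewrite -dotp_mulmx; apply: dotp_conv_le cx.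
move=> i j; apply/eqP/idP => [ij|/inc1//].
by apply/negPn/negP => /lt1; rewrite ij ltxx.
Unshelve. all: by end_near. Qed.

End Stability.

(** * The realization space near a realization *)

Section CenteredRealizations.
Context {R : realType}.

Lemma comb_equiv_trans e e' e'' n m (P : @labeled R e n m) (Q : @labeled R e' n m)
    (S : @labeled R e'' n m) :
  comb_equiv P Q -> comb_equiv Q S -> comb_equiv P S.
Proof.
move=> [f [fbij fle fv ff]] [g [gbij gle gv gf]]; exists (g \o f); split.
- exact: set_bij_comp fbij gbij.
- move=> G H PG PH; have [fhomo _ _] := fbij.
  by rewrite (fle _ _ PG PH) /=; apply: gle; apply: fhomo.
- by move=> i; rewrite /= fv gv.
- by move=> j; rewrite /= ff gf.
Qed.

Lemma comb_equiv_incidence e e' n m d (P : @labeled R e n m) (Q : @labeled R e' n m) i j :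
  labeled_polytope d P -> comb_equiv P Q ->
  facet P j (vertex P i) <-> facet Q j (vertex Q i).
Proof.
move=> [_ _ [_ vP] [_ fP]] [f [_ fle fv ff]].
have PV : face (body P) [set vertex P i] by apply/vP; exists i.
have [PF _] : face (body P) (facet P j) /\ affdim (facet P j) = d%:Z - 1.
  by apply/fP; exists j.
have := fle _ _ PV PF; rewrite fv ff => -[h1 h2].
by split=> [Pij|Qij]; [apply: h1|apply: h2] => // x ->.
Qed.

Variables (d e n m : nat) (P : @labeled R e n m).
Hypothesis polyP : labeled_polytope d P.

Let inc i j : bool := `[< facet P j (vertex P i) >].

(** The incidences of a centered realization are those of P, because v_i lies in F_j
    exactly when the face {v_i} is below the face F_j. *)
Lemma centered_polar_pair (W : 'M[R]_(d, n + m)) :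
  centered_realization_space P W -> polar_pair inc (lsubmx W) (rsubmx W).
Proof.
move=> [cA [_ eq]]; split=> // i j.
have := comb_equiv_incidence i j polyP eq => /= h.
apply/eqP/asboolP => [ij|/h[]//]; apply/h; split=> //.
exact: conv_vertex.
Qed.

Lemma char_map_eq0 (W : 'M[R]_(d, n + m)) :
  char_map P W = 0 <->
  forall i j, inc i j -> dotp (col j (rsubmx W)) (col i (lsubmx W)) = 1.
Proof.
split=> [W0 i j ij|W1]; last first.
  apply/rowP => k; rewrite [LHS]mxE [RHS]mxE /= dotpC W1 ?subrr //.
  by have := enum_valP k; rewrite inE.
have ijI : (i, j) \in incidences P by rewrite inE.
have /rowP/(_ (enum_rank_in ijI (i, j))) := W0.
by rewrite [X in X = _ -> _]mxE [X in _ = X -> _]mxE enum_rankK_in //= dotpC => /eqP; rewrite subr_eq0 => /eqP.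
Qed.

Lemma char_map_smooth : smooth_on [set: 'M[R]_(d, n + m)] (@char_map R e n m d P).
Proof.
apply/smooth_on_mxP => [|i k]; first exact: openT.
under [X in smooth_on _ X]funext do rewrite mxE /= dotpE.
apply: smooth_onD; [exact: openT| |exact: smooth_on_cst].
apply: smooth_on_sum => [|l _]; first exact: openT.
under [X in smooth_on _ X]funext do rewrite !mxE.
by apply: smooth_onM; [exact: openT|exact: smooth_on_coord..].
Qed.

(** The Jacobian of the statement is that of the map on row vectors; both are read
    through mxvec. *)
Lemma char_jacobian_jac (W : 'M[R]_(d, n + m)) :
  char_jacobian P W = (jac (@char_map R e n m d P) W)^T.
Proof.
rewrite /char_jacobian /jac /jacobian; congr (trmx _).
have dchar : differentiable (@char_map R e n m d P) W.
  by have [] := @C1_strict_diff R _ _ _ _ setT (@char_map R e n m d P) W openT I (char_map_smooth 1%N).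
apply/matrixP => i j; rewrite [LHS]mxE [RHS]mxE.
have dvec : differentiable (@vec_mx R d (n + m)) (mxvec W).
  by apply: linear_differentiable; apply: linear_mx_continuous.
rewrite (_ : (fun w => char_map P (vec_mx w)) = char_map P \o vec_mx) //.
rewrite diff_comp ?mxvecK //= diff_lin //.
exact: linear_mx_continuous.
Qed.

(** A realization has the incidences of P, so the characteristic map vanishes on it;
    the converse is [polar_pair_near] and [labeled_polytope_transfer]. *)
Lemma centered_realizations_near (V0 : 'M[R]_(d, n)) (A0 : 'M[R]_(d, m)) :
  centered_realization_space P (row_mx V0 A0) ->
  \forall W \near row_mx V0 A0,
    centered_realization_space P W <-> char_map P W = 0.
Proof.
move=> cW0; have := centered_polar_pair cW0; rewrite row_mxKl row_mxKr => VA0.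
(* In dimension 0 there is only one point (V, A); a facet is then the empty face,
   to which the hyperplane arguments do not apply. *)
have [dE|d0] := posnP d.
  near=> W; have WE : W = row_mx V0 A0.
    by apply/matrixP => i; have := ltn_ord i; rewrite [X in (_ < X)%N]dE.
  split=> [cW|_]; last by rewrite WE.
  by apply/char_map_eq0 => i j /(polar_pair_eq (centered_polar_pair cW)).
have lc : continuous (@lsubmx R d n m) by apply: linear_mx_continuous.
have dim_near I : \forall W \near row_mx V0 A0,
    affdim (conv_on V0 I) <= affdim (conv_on (lsubmx W) I).
  apply: (lc (row_mx V0 A0) (fun V => affdim (conv_on V0 I) <= affdim (conv_on V I))).
  by rewrite row_mxKl; apply: affdim_conv_on_near.
near=> W; split=> [cW|/char_map_eq0 W1].
  by apply/char_map_eq0 => i j /(polar_pair_eq (centered_polar_pair cW)).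
have VA : polar_pair inc (lsubmx W) (rsubmx W).
  by move: W1; near: W; exact: polar_pair_near.
have [_ [poly0 equiv0]] := cW0; rewrite !row_mxKl !row_mxKr in poly0 equiv0.
split; first by case: VA.
have [_ _ [vinj0 vface0] _] := poly0.
split.
  apply: (labeled_polytope_transfer d0 VA0 VA poly0) => // I.
  by move: I; near: W; apply: filter_forall => I; exact: dim_near.
apply: comb_equiv_trans equiv0 _.
by apply: (polar_pair_comb_equiv VA0 VA) => // i; apply/vface0; exists i.
Unshelve. all: by end_near. Qed.

End CenteredRealizations.

Theorem theorem3p8 (R : realType) (d e n m : nat) (P : @labeled R e n m)
    (V0 : 'M[R]_(d, n)) (A0 : 'M[R]_(d, m)) :
  labeled_polytope d P ->
  centered_realization_space P (row_mx V0 A0) ->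
  \rank (char_jacobian P (row_mx V0 A0)) = #|incidences P| ->
  [/\ exists (k : nat) (U : set 'M[R]_(d, n + m)),
        [/\ k%:Z = natural_guess d P,
            open_nbhs (row_mx V0 A0) U
          & smooth_submanifold k (centered_realization_space P `&` U)],
      has_local_dim (@centered_realization_space R e n m d P) (row_mx V0 A0)
        (natural_guess d P),
      natural_guess d P <= sdim (@centered_realization_space R e n m d P)
    & 0 <= natural_guess d P].
Proof.
move=> polyP cW0 rk; set W0 := row_mx V0 A0 in cW0 rk *.
have rkF : \rank (jac (@char_map R e n m d P) W0) = #|incidences P|.
  by move: rk; rewrite char_jacobian_jac mxrank_tr.
have [k [U [kr [oU UW0] _ sU]]] :=
  regular_level_set openT I (@char_map_smooth R d e n m P) rkF.
have kE : k%:Z = natural_guess d P by rewrite /natural_guess -kr PoszD addrK.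
rewrite -kE.
have [N [oN NW0] NP] : exists2 N, open_nbhs W0 N &
    forall W, N W -> (centered_realization_space P W <-> char_map P W = 0).
  exists [set W | centered_realization_space P W <-> char_map P W = 0]^°.
    by split; [exact: open_interior|exact: centered_realizations_near].
  by move=> W /interior_subset.
pose U' := U `&` N.
have oU' : open_nbhs W0 U' by split=> //; apply: openI.
have SE : centered_realization_space P `&` U' =
    [set W | char_map P W = 0] `&` U `&` N.
  apply/seteqP; split=> W [].
    by move=> cW [UW NW]; split=> //; split=> //=; apply/NP.
  by move=> [/= W0' UW] NW; split=> //; apply/NP.
have sS : smooth_submanifold k (centered_realization_space P `&` U').
  by rewrite SE; apply: smooth_submanifold_open.
split=> //.
- by exists k, U'.
- exists U'; first exact: open_nbhs_nbhs.
  move=> V VW0 VU'; pose O := V^°; have oO : open O by exact: open_interior.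
  have OV : O `<=` V by exact: interior_subset.
  have OE : centered_realization_space P `&` O =
      centered_realization_space P `&` U' `&` O.
    by rewrite -setIA [U' `&` O]setIC (setIidl (subset_trans OV VU')).
  apply: (@sdim_sandwich _ _ _ _ (centered_realization_space P `&` O) _
           (centered_realization_space P `&` U')) => //.
  + by exists W0.
  + exact: setIS.
  + exact: setIS.
  + by rewrite OE; apply: smooth_submanifold_open.
- apply: sdim_ge sS; first by exists W0; split=> //; case: oU'.
  exact: subIsetl.
Qed.
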